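(* Let $\mathds{k}$ be an algebraically closed field and let $\mathcal{C}$ be a fusion 1-category over $\mathds{k}$, i.e. a connected rigid algebra in $\mathbf{2Vect}$. Then the dimension $\mathrm{Dim}_{\mathbf{2Vect}}(\mathcal{C})$ of $\mathcal{C}$ as a connected rigid algebra in $\mathbf{2Vect}$ coincides with the global dimension $\mathrm{dim}(\mathcal{C})$ of the fusion 1-category $\mathcal{C}$.
   Context: A fusion 1-category over $\mathds{k}$ is a finite semisimple $\mathds{k}$-linear monoidal 1-category with left and right duals and simple monoidal unit $I$. $\mathbf{2Vect}$ is the symmetric monoidal 2-category of finite semisimple $\mathds{k}$-linear 1-categories ($\mathds{k}$ algebraically closed), linear functors and natural transformations, with the Deligne tensor product $\boxtimes$. Dimension. Let $T:\mathcal{C}\boxtimes\mathcal{C}\to\mathcal{C}$ be the tensor product functor, viewed as a $\mathcal{C}$-$\mathcal{C}$-bimodule functor (with $\mathcal{C}$ acting on the left on the first factor and on the right on the second factor of $\mathcal{C}\boxtimes\mathcal{C}$). All adjoints and natural transformations below are taken in the 2-category of finite semisimple $\mathcal{C}$-$\mathcal{C}$-bimodule 1-categories, bimodule functors and bimodule natural transformations. $T$ has a right adjoint $T^*$, with unit $\eta^T:Id\Rightarrow T^*\circ T$ and counit $\epsilon^T:T\circ T^*\Rightarrow Id_{\mathcal{C}}$, and $T^*$ has a right adjoint $T^{**}$, with unit $\eta^{T^*}:Id_{\mathcal{C}}\Rightarrow T^{**}\circ T^*$ and counit $\epsilon^{T^*}:T^*\circ T^{**}\Rightarrow Id$; moreover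 $End_{\mathcal{C}\text{-}\mathcal{C}}(T)\cong\mathds{k}$ and there is a bimodule natural isomorphism $\mu:T^{**}\cong T$. Define scalars $$\mathrm{Tr}(\mu):=\big(\epsilon^T\cdot(\mu\circ T^* )\cdot\eta^{T^*}\big)\circ T,\qquad \mathrm{Tr}((\mu^{-1})^* ):=T\circ\big(\epsilon^{T^*}\cdot(T^*\circ\mu^{-1})\cdot\eta^T\big)$$ in $End_{\mathcal{C}\text{-}\mathcal{C}}(T)=\mathds{k}$ ($\circ$ denotes composition of functors and whiskering, $\cdot$ vertical composition). Then $\mathrm{Dim}_{\mathbf{2Vect}}(\mathcal{C}):=\mathrm{Tr}(\mu)\cdot\mathrm{Tr}((\mu^{-1})^* )$, which is independent of all choices. Global dimension. For a simple object $X$ of $\mathcal{C}$ choose an isomorphism $a:X\to X^{**}$ ($X^{*}$ the dual) and let $|X|^2:=\mathrm{Tr}(a)\,\mathrm{Tr}((a^{-1})^* )\in\mathds{k}=End_{\mathcal{C}}(I)$, where $\mathrm{Tr}(a)$ is the composite $I\to X\otimes X^*\xrightarrow{a\otimes 1}X^{**}\otimes X^*\to I$ of coevaluation, $a\otimes 1$ and evaluation, and $\mathrm{Tr}((a^{-1})^* )$ is the analogous trace of $(a^{-1})^*:X^*\to X^{***}$; this is independent of $a$. The global dimension is $\mathrm{dim}(\mathcal{C}):=\sum_X|X|^2$, over isomorphism classes of simple objects (Definition 2.6.3 of Douglas–Schommer-Pries–Snyder, Dualizable tensor categories). *)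

(* Defs.v *)
(* MathComp world. *)
From Stdlib Require Import ClassicalEpsilon.
From mathcomp Require Import all_boot all_order all_algebra.
Set Implicit Arguments.
Unset Strict Implicit.
Unset Printing Implicit Defensive.
Import GRing.Theory.
Local Open Scope ring_scope.

Declare Scope lincat_scope.
Delimit Scope lincat_scope with lincat.

(** * Linear categories *)

(* Morphism spaces are finite-dimensional, since [vectType] is. *)
Record lincat (k : closedFieldType) := LinCat {
  ob :> Type;
  hom : ob -> ob -> vectType k;
  idm : forall X, hom X X;
  comp : forall X Y Z, hom Y Z -> hom X Y -> hom X Z;
  comp_idl : forall X Y (f : hom X Y), comp (idm Y) f = f;
  comp_idr : forall X Y (f : hom X Y), comp f (idm X) = f;
  comp_assoc : forall W X Y Z (h : hom Y Z) (g : hom X Y) (f : hom W X),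
    comp h (comp g f) = comp (comp h g) f;
  comp_linear_l : forall X Y Z (f : hom X Y), linear (fun g : hom Y Z => comp g f);
  comp_linear_r : forall X Y Z (g : hom Y Z), linear (fun f : hom X Y => comp g f)
}.
Arguments hom {k l} _ _.
Arguments idm {k l} X.
Arguments comp {k l X Y Z} _ _.

Notation "g ∘ f" := (comp g f) (at level 40, left associativity) : lincat_scope.
Local Open Scope lincat_scope.

Record iso (k : closedFieldType) (C : lincat k) (X Y : C) := Iso {
  fwd : hom X Y;
  bwd : hom Y X;
  bwd_fwd : bwd ∘ fwd = idm X;
  fwd_bwd : fwd ∘ bwd = idm Y
}.

Definition isomorphic (k : closedFieldType) (C : lincat k) (X Y : C) : Prop :=
  inhabited (iso X Y).

Lemma iso_id_subproof (k : closedFieldType) (C : lincat k) (X : C) :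
  idm X ∘ idm X = idm X.
Proof. exact: comp_idl. Qed.

Definition iso_id (k : closedFieldType) (C : lincat k) (X : C) : iso X X :=
  Iso (iso_id_subproof X) (iso_id_subproof X).

(** ** Finite semisimple categories *)

Section FiniteSemisimple.
Variables (k : closedFieldType) (C : lincat k).

Definition is_zero (X : C) : Prop := idm X = 0.

Definition mono (X Y : C) (i : hom X Y) : Prop :=
  forall (W : C) (f g : hom W X), i ∘ f = i ∘ g -> f = g.

Definition epi (X Y : C) (p : hom X Y) : Prop :=
  forall (Z : C) (f g : hom Y Z), f ∘ p = g ∘ p -> f = g.

Definition is_iso (X Y : C) (f : hom X Y) : Prop :=
  exists g : hom Y X, g ∘ f = idm X /\ f ∘ g = idm Y.

(* For n = 0 this says that Z is a zero object. *)
Definition is_direct_sum (n : nat) (Y : 'I_n -> C) (Z : C) : Prop :=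
  exists (inj : forall i, hom (Y i) Z) (proj : forall i, hom Z (Y i)),
    [/\ forall i, proj i ∘ inj i = idm (Y i),
        forall i j, i != j -> proj j ∘ inj i = 0
      & \sum_(i < n) (inj i ∘ proj i) = idm Z].

Definition is_kernel (K X Y : C) (f : hom X Y) (i : hom K X) : Prop :=
  f ∘ i = 0 /\
  forall (W : C) (g : hom W X), f ∘ g = 0 -> exists! h : hom W K, i ∘ h = g.

Definition is_cokernel (X Y Q : C) (f : hom X Y) (p : hom Y Q) : Prop :=
  p ∘ f = 0 /\
  forall (Z : C) (g : hom Y Z), g ∘ f = 0 -> exists! h : hom Q Z, h ∘ p = g.

Definition additive : Prop :=
  forall (n : nat) (Y : 'I_n -> C), exists Z : C, is_direct_sum Y Z.

Definition abelian_cat : Prop :=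
  [/\ additive,
      forall (X Y : C) (f : hom X Y), exists (K : C) (i : hom K X), is_kernel f i,
      forall (X Y : C) (f : hom X Y), exists (Q : C) (p : hom Y Q), is_cokernel f p,
      forall (X Y : C) (i : hom X Y), mono i ->
        exists (Z : C) (f : hom Y Z), is_kernel f i
    & forall (X Y : C) (p : hom X Y), epi p ->
        exists (W : C) (f : hom W X), is_cokernel f p].

(* A monomorphism Y -> S is the zero subobject iff Y is a zero object. *)
Definition simple_ob (S : C) : Prop :=
  ~ is_zero S /\
  forall (Y : C) (i : hom Y S), mono i -> is_zero Y \/ is_iso i.

Definition simple_reps (n : nat) (X : 'I_n -> C) : Prop :=
  [/\ forall i, simple_ob (X i),
      forall i j, isomorphic (X i) (X j) -> i = j
    & forall S : C, simple_ob S -> exists i, isomorphic S (X i)].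

Definition finite_semisimple : Prop :=
  [/\ abelian_cat,
      forall Z : C, exists (n : nat) (Y : 'I_n -> C),
        (forall i, simple_ob (Y i)) /\ is_direct_sum Y Z
    & exists (n : nat) (X : 'I_n -> C), simple_reps X].

End FiniteSemisimple.

(** ** Linear and bilinear functors *)

Record lfunctor (k : closedFieldType) (C D : lincat k) := LFunctor {
  fob :> C -> D;
  fmap : forall X Y, hom X Y -> hom (fob X) (fob Y);
  fmap_id : forall X, fmap (idm X) = idm (fob X);
  fmap_comp : forall X Y Z (g : hom Y Z) (f : hom X Y),
    fmap (g ∘ f) = fmap g ∘ fmap f;
  fmap_linear : forall X Y, linear (@fmap X Y)
}.
Arguments fmap {k C D} l {X Y} _.

Record bifunctor (k : closedFieldType) (C D E : lincat k) := BiFunctor {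
  bob :> C -> D -> E;
  bmap : forall X X' Y Y', hom X X' -> hom Y Y' -> hom (bob X Y) (bob X' Y');
  bmap_id : forall X Y, bmap (idm X) (idm Y) = idm (bob X Y);
  bmap_comp : forall X X' X'' Y Y' Y''
      (f' : hom X' X'') (f : hom X X') (g' : hom Y' Y'') (g : hom Y Y'),
    bmap (f' ∘ f) (g' ∘ g) = bmap f' g' ∘ bmap f g;
  bmap_linear_l : forall X X' Y Y' (g : hom Y Y'),
    linear (fun f : hom X X' => bmap f g);
  bmap_linear_r : forall X X' Y Y' (f : hom X X'),
    linear (fun g : hom Y Y' => bmap f g)
}.
Arguments bmap {k C D E} b {X X' Y Y'} _ _.

(** ** The Deligne tensor product *)

Section Deligne.
Variables (k : closedFieldType) (C D P : lincat k) (B : bifunctor C D P).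

(* Restriction of natural transformations along B: the datum of a natural
   transformation F (B - -) => G (B - -). *)
Definition natural_on (E : lincat k) (F G : lfunctor P E)
    (t : forall X Y, hom (F (B X Y)) (G (B X Y))) : Prop :=
  forall X X' Y Y' (f : hom X X') (g : hom Y Y'),
    fmap G (bmap B f g) ∘ t X Y = t X' Y' ∘ fmap F (bmap B f g).

Definition natural (E : lincat k) (F G : lfunctor P E)
    (t : forall W, hom (F W) (G W)) : Prop :=
  forall W W' (f : hom W W'), fmap G f ∘ t W = t W' ∘ fmap F f.

(* Restriction along B is an equivalence from linear functors P -> E to bilinear
   functors C x D -> E, for every finite semisimple E.  Right exactness in each
   variable is automatic, the categories being semisimple. *)
Definition is_deligne : Prop :=
  forall E : lincat k, finite_semisimple E ->
    (forall H : bifunctor C D E,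
       exists (F : lfunctor P E) (s : forall X Y, iso (F (B X Y)) (H X Y)),
         forall X X' Y Y' (f : hom X X') (g : hom Y Y'),
           bmap H f g ∘ fwd (s X Y) = fwd (s X' Y') ∘ fmap F (bmap B f g)) /\
    (forall (F G : lfunctor P E) (t : forall X Y, hom (F (B X Y)) (G (B X Y))),
       natural_on t ->
       exists t' : forall W, hom (F W) (G W),
         [/\ natural t', forall X Y, t' (B X Y) = t X Y
           & forall t'' : forall W, hom (F W) (G W),
               natural t'' -> (forall X Y, t'' (B X Y) = t X Y) ->
               forall W, t'' W = t' W]).

End Deligne.

(** * Fusion categories *)

Record moncat (k : closedFieldType) := MonCat {
  mcat :> lincat k;
  unit_ob : mcat;
  tens : bifunctor mcat mcat mcat;
  assoc : forall X Y Z, iso (tens (tens X Y) Z) (tens X (tens Y Z));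
  lunit : forall X, iso (tens unit_ob X) X;
  runit : forall X, iso (tens X unit_ob) X;
  assoc_nat : forall X X' Y Y' Z Z' (f : hom X X') (g : hom Y Y') (h : hom Z Z'),
    bmap tens f (bmap tens g h) ∘ fwd (assoc X Y Z)
    = fwd (assoc X' Y' Z') ∘ bmap tens (bmap tens f g) h;
  lunit_nat : forall X X' (f : hom X X'),
    f ∘ fwd (lunit X) = fwd (lunit X') ∘ bmap tens (idm unit_ob) f;
  runit_nat : forall X X' (f : hom X X'),
    f ∘ fwd (runit X) = fwd (runit X') ∘ bmap tens f (idm unit_ob);
  pentagon : forall W X Y Z,
    fwd (assoc W X (tens Y Z)) ∘ fwd (assoc (tens W X) Y Z)
    = bmap tens (idm W) (fwd (assoc X Y Z)) ∘ fwd (assoc W (tens X Y) Z)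
      ∘ bmap tens (fwd (assoc W X Y)) (idm Z);
  triangle : forall X Y,
    bmap tens (idm X) (fwd (lunit Y)) ∘ fwd (assoc X unit_ob Y)
    = bmap tens (fwd (runit X)) (idm Y)
}.
Arguments unit_ob {k m}.
Arguments tens {k} m.
Arguments assoc {k m} X Y Z.
Arguments lunit {k m} X.
Arguments runit {k m} X.

Notation "X ⊗ Y" := (bob (tens _) X Y) (at level 39, left associativity) : lincat_scope.
Notation "f ⊗₁ g" := (bmap (tens _) f g) (at level 39, left associativity) : lincat_scope.

(* L is a left dual of X (equivalently, X is a right dual of L). *)
Record duality (k : closedFieldType) (C : moncat k) (L X : C) := Duality {
  ev : hom (L ⊗ X) unit_ob;
  coev : hom unit_ob (X ⊗ L);
  zigzag_r : fwd (runit X) ∘ (idm X ⊗₁ ev) ∘ fwd (assoc X L X)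
    ∘ (coev ⊗₁ idm X) ∘ bwd (lunit X) = idm X;
  zigzag_l : fwd (lunit L) ∘ (ev ⊗₁ idm L) ∘ bwd (assoc L X L)
    ∘ (idm L ⊗₁ coev) ∘ bwd (runit L) = idm L
}.

Record fusion (k : closedFieldType) := Fusion {
  fmon :> moncat k;
  fusion_fss : finite_semisimple fmon;
  dual : fmon -> fmon;
  dualP : forall X, duality (dual X) X;
  rdual : fmon -> fmon;
  rdualP : forall X, duality X (rdual X);
  unit_simple : simple_ob (@unit_ob k fmon)
}.

Section GlobalDimension.
Variables (k : closedFieldType) (C : fusion k).

Definition evm (X : C) : hom (dual X ⊗ X) unit_ob := ev (dualP X).
Definition coevm (X : C) : hom unit_ob (X ⊗ dual X) := coev (dualP X).

Definition dual_map (X Y : C) (f : hom X Y) : hom (dual Y) (dual X) :=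
  fwd (lunit (dual X)) ∘ (evm Y ⊗₁ idm (dual X))
  ∘ ((idm (dual Y) ⊗₁ f) ⊗₁ idm (dual X))
  ∘ bwd (assoc (dual Y) X (dual X))
  ∘ (idm (dual Y) ⊗₁ coevm X) ∘ bwd (runit (dual Y)).

Definition trace_hom (X : C) (a : hom X (dual (dual X))) : hom (@unit_ob k C) unit_ob :=
  evm (dual X) ∘ (a ⊗₁ idm (dual X)) ∘ coevm X.

(* The identification of End(I) with k: the scalar c such that f = c id. *)
Definition unit_scalar (f : hom (@unit_ob k C) unit_ob) : k :=
  epsilon (inhabits 0) (fun c => f = c *: idm unit_ob).

Definition sqnorm (X : C) (a : iso X (dual (dual X))) : k :=
  unit_scalar (trace_hom (fwd a))
  * unit_scalar (trace_hom (dual_map (bwd a))).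

(* X is meant to be a family of representatives, see [simple_reps]. *)
Definition global_dim (n : nat) (X : 'I_n -> C)
    (a : forall i, iso (X i) (dual (dual (X i)))) : k :=
  \sum_(i < n) sqnorm (a i).

End GlobalDimension.

(** * The 2-category of finite semisimple C-C-bimodule categories *)

Record bimod (k : closedFieldType) (C : moncat k) := BiMod {
  bcat :> lincat k;
  bimod_fss : finite_semisimple bcat;
  lact : bifunctor C bcat bcat;
  ract : bifunctor bcat C bcat;
  lassoc : forall (X Y : C) (m : bcat), iso (lact (X ⊗ Y) m) (lact X (lact Y m));
  rassoc : forall (m : bcat) (X Y : C), iso (ract (ract m X) Y) (ract m (X ⊗ Y));
  massoc : forall (X : C) (m : bcat) (Y : C),
    iso (ract (lact X m) Y) (lact X (ract m Y));
  lactu : forall m : bcat, iso (lact unit_ob m) m;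
  ractu : forall m : bcat, iso (ract m unit_ob) m;
  lassoc_nat : forall X X' Y Y' m m' (f : hom X X') (g : hom Y Y') (h : hom m m'),
    bmap lact f (bmap lact g h) ∘ fwd (lassoc X Y m)
    = fwd (lassoc X' Y' m') ∘ bmap lact (f ⊗₁ g) h;
  rassoc_nat : forall m m' X X' Y Y' (h : hom m m') (f : hom X X') (g : hom Y Y'),
    bmap ract h (f ⊗₁ g) ∘ fwd (rassoc m X Y)
    = fwd (rassoc m' X' Y') ∘ bmap ract (bmap ract h f) g;
  massoc_nat : forall X X' m m' Y Y' (f : hom X X') (h : hom m m') (g : hom Y Y'),
    bmap lact f (bmap ract h g) ∘ fwd (massoc X m Y)
    = fwd (massoc X' m' Y') ∘ bmap ract (bmap lact f h) g;
  lactu_nat : forall m m' (h : hom m m'),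
    h ∘ fwd (lactu m) = fwd (lactu m') ∘ bmap lact (idm unit_ob) h;
  ractu_nat : forall m m' (h : hom m m'),
    h ∘ fwd (ractu m) = fwd (ractu m') ∘ bmap ract h (idm unit_ob);
  lact_pentagon : forall X Y Z m,
    fwd (lassoc X Y (lact Z m)) ∘ fwd (lassoc (X ⊗ Y) Z m)
    = bmap lact (idm X) (fwd (lassoc Y Z m)) ∘ fwd (lassoc X (Y ⊗ Z) m)
      ∘ bmap lact (fwd (assoc X Y Z)) (idm m);
  ract_pentagon : forall m X Y Z,
    fwd (rassoc m X (Y ⊗ Z)) ∘ fwd (rassoc (ract m X) Y Z)
    = bmap ract (idm m) (fwd (assoc X Y Z)) ∘ fwd (rassoc m (X ⊗ Y) Z)
      ∘ bmap ract (fwd (rassoc m X Y)) (idm Z);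
  llr_pentagon : forall X Y m Z,
    fwd (lassoc X Y (ract m Z)) ∘ fwd (massoc (X ⊗ Y) m Z)
    = bmap lact (idm X) (fwd (massoc Y m Z)) ∘ fwd (massoc X (lact Y m) Z)
      ∘ bmap ract (fwd (lassoc X Y m)) (idm Z);
  lrr_pentagon : forall X m Y Z,
    fwd (massoc X m (Y ⊗ Z)) ∘ fwd (rassoc (lact X m) Y Z)
    = bmap lact (idm X) (fwd (rassoc m Y Z)) ∘ fwd (massoc X (ract m Y) Z)
      ∘ bmap ract (fwd (massoc X m Y)) (idm Z);
  lact_triangle : forall X m,
    bmap lact (idm X) (fwd (lactu m)) ∘ fwd (lassoc X unit_ob m)
    = bmap lact (fwd (runit X)) (idm m);
  ract_triangle : forall m Y,
    bmap ract (idm m) (fwd (lunit Y)) ∘ fwd (rassoc m unit_ob Y)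
    = bmap ract (fwd (ractu m)) (idm Y)
}.
Arguments lact {k C} b.
Arguments ract {k C} b.
Arguments lassoc {k C b} X Y m.
Arguments rassoc {k C b} m X Y.
Arguments massoc {k C b} X m Y.
Arguments lactu {k C b} m.
Arguments ractu {k C b} m.

Notation "X ▷ m" := (bob (lact _) X m) (at level 38, right associativity) : lincat_scope.
Notation "m ◁ X" := (bob (ract _) m X) (at level 39, left associativity) : lincat_scope.
Notation "f ▷₁ g" := (bmap (lact _) f g) (at level 38, right associativity) : lincat_scope.
Notation "g ◁₁ f" := (bmap (ract _) g f) (at level 39, left associativity) : lincat_scope.

Definition regular (k : closedFieldType) (C : fusion k) : bimod C :=
  @BiMod k C C (fusion_fss C) (tens C) (tens C) assoc assoc assoc lunit runit
    (@assoc_nat k C) (@assoc_nat k C) (@assoc_nat k C) (@lunit_nat k C) (@runit_nat k C)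
    (@pentagon k C) (@pentagon k C) (@pentagon k C) (@pentagon k C)
    (@triangle k C) (@triangle k C).

Record bimod_functor (k : closedFieldType) (C : moncat k) (M N : bimod C) := BFun {
  bfun :> lfunctor M N;
  lstr : forall (X : C) (m : M), iso (bfun (X ▷ m)) (X ▷ bfun m);
  rstr : forall (m : M) (X : C), iso (bfun (m ◁ X)) (bfun m ◁ X);
  lstr_nat : forall X X' m m' (f : hom X X') (h : hom m m'),
    (f ▷₁ fmap bfun h) ∘ fwd (lstr X m) = fwd (lstr X' m') ∘ fmap bfun (f ▷₁ h);
  rstr_nat : forall m m' X X' (h : hom m m') (f : hom X X'),
    (fmap bfun h ◁₁ f) ∘ fwd (rstr m X) = fwd (rstr m' X') ∘ fmap bfun (h ◁₁ f);
  lstr_assoc : forall X Y m,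
    fwd (lassoc X Y (bfun m)) ∘ fwd (lstr (X ⊗ Y) m)
    = (idm X ▷₁ fwd (lstr Y m)) ∘ fwd (lstr X (Y ▷ m)) ∘ fmap bfun (fwd (lassoc X Y m));
  rstr_assoc : forall m X Y,
    fwd (rstr m (X ⊗ Y)) ∘ fmap bfun (fwd (rassoc m X Y))
    = fwd (rassoc (bfun m) X Y) ∘ (fwd (rstr m X) ◁₁ idm Y) ∘ fwd (rstr (m ◁ X) Y);
  lrstr_assoc : forall X m Y,
    (idm X ▷₁ fwd (rstr m Y)) ∘ fwd (lstr X (m ◁ Y)) ∘ fmap bfun (fwd (massoc X m Y))
    = fwd (massoc X (bfun m) Y) ∘ (fwd (lstr X m) ◁₁ idm Y) ∘ fwd (rstr (X ▷ m) Y);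
  lstr_unit : forall m,
    fwd (lactu (bfun m)) ∘ fwd (lstr unit_ob m) = fmap bfun (fwd (lactu m));
  rstr_unit : forall m,
    fwd (ractu (bfun m)) ∘ fwd (rstr m unit_ob) = fmap bfun (fwd (ractu m))
}.
Arguments lstr {k C M N} b X m.
Arguments rstr {k C M N} b m X.

Record bimod_nat (k : closedFieldType) (C : moncat k) (M N : bimod C)
    (F G : bimod_functor M N) := BNat {
  bnat :> forall m : M, hom (F m) (G m);
  bnat_nat : forall m m' (h : hom m m'), fmap G h ∘ bnat m = bnat m' ∘ fmap F h;
  bnat_l : forall X m,
    (idm X ▷₁ bnat m) ∘ fwd (lstr F X m) = fwd (lstr G X m) ∘ bnat (X ▷ m);
  bnat_r : forall m X,
    (bnat m ◁₁ idm X) ∘ fwd (rstr F m X) = fwd (rstr G m X) ∘ bnat (m ◁ X)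
}.

Section Functors.
Variables (k : closedFieldType) (C : moncat k).

Lemma bmap_idl_comp (A B E : lincat k) (H : bifunctor A B E) (X : A)
    (Y Y' Y'' : B) (g' : hom Y' Y'') (g : hom Y Y') :
  bmap H (idm X) (g' ∘ g) = bmap H (idm X) g' ∘ bmap H (idm X) g.
Proof. by rewrite -bmap_comp comp_idl. Qed.

Lemma bmap_idr_comp (A B E : lincat k) (H : bifunctor A B E) (Y : B)
    (X X' X'' : A) (f' : hom X' X'') (f : hom X X') :
  bmap H (f' ∘ f) (idm Y) = bmap H f' (idm Y) ∘ bmap H f (idm Y).
Proof. by rewrite -bmap_comp comp_idl. Qed.

Definition lid (A : lincat k) : lfunctor A A.
Proof. by exists (fun X => X) (fun X Y f => f). Defined.

Definition lcomp (A B E : lincat k) (G : lfunctor B E) (F : lfunctor A B) : lfunctor A E.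
Proof.
exists (fun X => G (F X)) (fun X Y f => fmap G (fmap F f)).
- by move=> X; rewrite !fmap_id.
- by move=> X Y Z g f; rewrite !fmap_comp.
- by move=> X Y a f g; rewrite !fmap_linear.
Defined.

Definition iso_comp (A : lincat k) (X Y Z : A) (g : iso Y Z) (f : iso X Y) : iso X Z.
Proof.
exists (fwd g ∘ fwd f) (bwd f ∘ bwd g).
- by rewrite -comp_assoc (comp_assoc (bwd g)) bwd_fwd comp_idl bwd_fwd.
- by rewrite -comp_assoc (comp_assoc (fwd f)) fwd_bwd comp_idl fwd_bwd.
Defined.

Definition iso_map (A B : lincat k) (F : lfunctor A B) (X Y : A) (f : iso X Y) :
  iso (F X) (F Y).
Proof.
exists (fmap F (fwd f)) (fmap F (bwd f)).
- by rewrite -fmap_comp bwd_fwd fmap_id.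
- by rewrite -fmap_comp fwd_bwd fmap_id.
Defined.

Definition bid (M : bimod C) : bimod_functor M M.
Proof.
exists (lid M) (fun X m => iso_id (X ▷ m)) (fun m X => iso_id (m ◁ X)) => /=.
- by move=> *; rewrite comp_idl comp_idr.
- by move=> *; rewrite comp_idl comp_idr.
- by move=> *; rewrite bmap_id !comp_idl comp_idr.
- by move=> *; rewrite bmap_id !comp_idl !comp_idr.
- by move=> *; rewrite !bmap_id !comp_idl !comp_idr.
- by move=> *; rewrite comp_idr.
- by move=> *; rewrite comp_idr.
Defined.

Definition bcomp (M N L : bimod C) (G : bimod_functor N L) (F : bimod_functor M N) :
  bimod_functor M L.
Proof.
exists (lcomp G F)
  (fun X m => iso_comp (lstr G X (F m)) (iso_map G (lstr F X m)))
  (fun m X => iso_comp (rstr G (F m) X) (iso_map G (rstr F m X))) => /=.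
- move=> X X' m m' f h.
  by rewrite comp_assoc lstr_nat -!comp_assoc -!fmap_comp lstr_nat.
- move=> m m' X X' h f.
  by rewrite comp_assoc rstr_nat -!comp_assoc -!fmap_comp rstr_nat.
- move=> X Y m.
  rewrite comp_assoc lstr_assoc bmap_idl_comp -!comp_assoc -!fmap_comp lstr_assoc.
  rewrite !fmap_comp !comp_assoc; do 2 congr (_ ∘ _).
  by rewrite -!comp_assoc lstr_nat.
- move=> m X Y.
  rewrite -comp_assoc -fmap_comp rstr_assoc bmap_idr_comp !fmap_comp !comp_assoc.
  rewrite rstr_assoc; congr (_ ∘ _).
  by rewrite -!comp_assoc rstr_nat.
- move=> X m Y.
  rewrite bmap_idl_comp bmap_idr_comp -!comp_assoc.
  rewrite (comp_assoc (idm X ▷₁ fmap G _)) lstr_nat -!comp_assoc -!fmap_comp.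
  rewrite (comp_assoc (idm X ▷₁ fwd (rstr F _ _))) lrstr_assoc !fmap_comp !comp_assoc lrstr_assoc.
  by rewrite -!comp_assoc (comp_assoc (fwd (rstr G _ _))) -rstr_nat -!comp_assoc.
- by move=> m; rewrite comp_assoc lstr_unit -fmap_comp lstr_unit.
- by move=> m; rewrite comp_assoc rstr_unit -fmap_comp rstr_unit.
Defined.

End Functors.

(** ** Bimodule natural transformations *)

Section Transformations.
Variables (k : closedFieldType) (C : moncat k).

Definition nvcomp (M N : bimod C) (F G H : bimod_functor M N)
    (t : bimod_nat G H) (s : bimod_nat F G) : bimod_nat F H.
Proof.
exists (fun m => t m ∘ s m).
- by move=> m m' h; rewrite comp_assoc bnat_nat -!comp_assoc bnat_nat.
- move=> X m; rewrite bmap_idl_comp -comp_assoc bnat_l !comp_assoc.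
  by rewrite bnat_l.
- move=> m X; rewrite bmap_idr_comp -comp_assoc bnat_r !comp_assoc.
  by rewrite bnat_r.
Defined.

Definition nwhisker_l (M N L : bimod C) (G : bimod_functor N L)
    (F F' : bimod_functor M N) (t : bimod_nat F F') :
  bimod_nat (bcomp G F) (bcomp G F').
Proof.
exists (fun m => fmap G (t m)) => /=.
- by move=> m m' h; rewrite -!fmap_comp bnat_nat.
- by move=> X m; rewrite comp_assoc lstr_nat -!comp_assoc -!fmap_comp bnat_l.
- by move=> m X; rewrite comp_assoc rstr_nat -!comp_assoc -!fmap_comp bnat_r.
Defined.

Definition nwhisker_r (M N L : bimod C) (G G' : bimod_functor N L)
    (t : bimod_nat G G') (F : bimod_functor M N) :
  bimod_nat (bcomp G F) (bcomp G' F).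
Proof.
exists (fun m => t (F m)) => /=.
- by move=> m m' h; rewrite bnat_nat.
- by move=> X m; rewrite comp_assoc bnat_l -!comp_assoc bnat_nat.
- by move=> m X; rewrite comp_assoc bnat_r -!comp_assoc bnat_nat.
Defined.

Definition nlunit (M N : bimod C) (F : bimod_functor M N) :
  bimod_nat (bcomp (bid N) F) F.
Proof.
refine (@BNat k C _ _ (bcomp (bid N) F) F (fun m => idm (F m)) _ _ _) => /= *;
  by rewrite ?bmap_id !(comp_idl, comp_idr).
Defined.

Definition nlunit_inv (M N : bimod C) (F : bimod_functor M N) :
  bimod_nat F (bcomp (bid N) F).
Proof.
refine (@BNat k C _ _ F (bcomp (bid N) F) (fun m => idm (F m)) _ _ _) => /= *;
  by rewrite ?bmap_id !(comp_idl, comp_idr).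
Defined.

Definition nrunit (M N : bimod C) (F : bimod_functor M N) :
  bimod_nat (bcomp F (bid M)) F.
Proof.
refine (@BNat k C _ _ (bcomp F (bid M)) F (fun m => idm (F m)) _ _ _) => /= *;
  by rewrite ?fmap_id ?bmap_id !(comp_idl, comp_idr).
Defined.

Definition nrunit_inv (M N : bimod C) (F : bimod_functor M N) :
  bimod_nat F (bcomp F (bid M)).
Proof.
refine (@BNat k C _ _ F (bcomp F (bid M)) (fun m => idm (F m)) _ _ _) => /= *;
  by rewrite ?fmap_id ?bmap_id !(comp_idl, comp_idr).
Defined.

Record bimod_iso (M N : bimod C) (F G : bimod_functor M N) := BIso {
  nfwd : bimod_nat F G;
  nbwd : bimod_nat G F;
  nbwd_fwd : forall m, nbwd m ∘ nfwd m = idm (F m);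
  nfwd_bwd : forall m, nfwd m ∘ nbwd m = idm (G m)
}.

(* F is left adjoint to G. *)
Record adjunction (M N : bimod C) (F : bimod_functor M N) (G : bimod_functor N M) :=
  Adjunction {
  adj_unit : bimod_nat (bid M) (bcomp G F);
  adj_counit : bimod_nat (bcomp F G) (bid N);
  adj_triangle_l : forall m, adj_counit (F m) ∘ fmap F (adj_unit m) = idm (F m);
  adj_triangle_r : forall n, fmap G (adj_counit n) ∘ adj_unit (G n) = idm (G n)
}.

(* The scalar c such that t = c id; used for F = T, where End(T) = k. *)
Definition bnat_scalar (M N : bimod C) (F : bimod_functor M N) (t : bimod_nat F F) : k :=
  epsilon (inhabits 0) (fun c => forall m, t m = c *: idm (F m)).

End Transformations.

(** * The dimension of a fusion category in 2Vect *)

(* C-C-bimodule structure of the Deligne product of C with itself: P is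
   a bimodule whose actions are given by X ▷ (A ⊠ B) = (X ⊗ A) ⊠ B and
   (A ⊠ B) ◁ Y = A ⊠ (B ⊗ Y), up to coherent isomorphism. *)
Record deligne_square (k : closedFieldType) (C : fusion k) := DeligneSquare {
  dsq :> bimod C;
  box : bifunctor C C dsq;
  box_deligne : is_deligne box;
  boxl : forall (X A B : C), iso (X ▷ box A B) (box (X ⊗ A) B);
  boxr : forall (A B Y : C), iso (box A B ◁ Y) (box A (B ⊗ Y));
  boxl_nat : forall X X' A A' B B' (f : hom X X') (g : hom A A') (h : hom B B'),
    bmap box (f ⊗₁ g) h ∘ fwd (boxl X A B) = fwd (boxl X' A' B') ∘ (f ▷₁ bmap box g h);
  boxr_nat : forall A A' B B' Y Y' (g : hom A A') (h : hom B B') (f : hom Y Y'),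
    bmap box g (h ⊗₁ f) ∘ fwd (boxr A B Y) = fwd (boxr A' B' Y') ∘ (bmap box g h ◁₁ f);
  boxl_assoc : forall X Y A B,
    bmap box (fwd (assoc X Y A)) (idm B) ∘ fwd (boxl (X ⊗ Y) A B)
    = fwd (boxl X (Y ⊗ A) B) ∘ (idm X ▷₁ fwd (boxl Y A B))
      ∘ fwd (lassoc X Y (box A B));
  boxr_assoc : forall A B X Y,
    fwd (boxr A B (X ⊗ Y)) ∘ fwd (rassoc (box A B) X Y)
    = bmap box (idm A) (fwd (assoc B X Y)) ∘ fwd (boxr A (B ⊗ X) Y)
      ∘ (fwd (boxr A B X) ◁₁ idm Y);
  boxlr_assoc : forall X A B Y,
    fwd (boxl X A (B ⊗ Y)) ∘ (idm X ▷₁ fwd (boxr A B Y)) ∘ fwd (massoc X (box A B) Y)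
    = fwd (boxr (X ⊗ A) B Y) ∘ (fwd (boxl X A B) ◁₁ idm Y);
  boxl_unit : forall A B,
    fwd (lactu (box A B)) = bmap box (fwd (lunit A)) (idm B) ∘ fwd (boxl unit_ob A B);
  boxr_unit : forall A B,
    fwd (ractu (box A B)) = bmap box (idm A) (fwd (runit B)) ∘ fwd (boxr A B unit_ob)
}.
Arguments box {k C} d.
Arguments boxl {k C d} X A B.
Arguments boxr {k C d} A B Y.

(* The bimodule functor with T (A ⊠ B) = A ⊗ B and bimodule structure given by the
   associator of C. *)
Record tensor_functor (k : closedFieldType) (C : fusion k) (P : deligne_square C) :=
  TensorFunctor {
  tfun :> bimod_functor P (regular C);
  tbox : forall A B : C, iso (tfun (box P A B) : C) (A ⊗ B);
  tbox_nat : forall A A' B B' (f : hom A A') (g : hom B B'),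
    (f ⊗₁ g) ∘ fwd (tbox A B) = fwd (tbox A' B') ∘ fmap tfun (bmap (box P) f g);
  tbox_l : forall X A B,
    fwd (assoc X A B) ∘ fwd (tbox (X ⊗ A) B) ∘ fmap tfun (fwd (boxl X A B))
    = (idm X ⊗₁ fwd (tbox A B)) ∘ fwd (lstr tfun X (box P A B));
  tbox_r : forall A B Y,
    fwd (tbox A (B ⊗ Y)) ∘ fmap tfun (fwd (boxr A B Y))
    = fwd (assoc A B Y) ∘ (fwd (tbox A B) ⊗₁ idm Y) ∘ fwd (rstr tfun (box P A B) Y)
}.

Section Dim2Vect.
Variables (k : closedFieldType) (C : fusion k) (P : deligne_square C).
Variables (T : bimod_functor P (regular C)) (Ts : bimod_functor (regular C) P)
  (Tss : bimod_functor P (regular C)).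
Variables (adjT : adjunction T Ts) (adjTs : adjunction Ts Tss).
Variable mu : bimod_iso Tss T.

Definition trace_mu : bimod_nat T T :=
  nvcomp (nlunit T)
    (nvcomp
      (nwhisker_r
        (nvcomp (adj_counit adjT)
          (nvcomp (nwhisker_r (nfwd mu) Ts) (adj_unit adjTs)))
        T)
      (nlunit_inv T)).

Definition trace_mu_inv_dual : bimod_nat T T :=
  nvcomp (nrunit T)
    (nvcomp
      (nwhisker_l T
        (nvcomp (adj_counit adjTs)
          (nvcomp (nwhisker_l Ts (nbwd mu)) (adj_unit adjT))))
      (nrunit_inv T)).

Definition dim_2Vect : k := bnat_scalar trace_mu * bnat_scalar trace_mu_inv_dual.

End Dim2Vect.

(* Main.v *)
From Stdlib Require Import ClassicalEpsilon.
From HB Require Import structures.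
From mathcomp Require Import all_boot all_order all_algebra.
Require Import Defs.
Set Implicit Arguments.
Unset Strict Implicit.
Unset Printing Implicit Defensive.
Import GRing.Theory VectorInternalTheory.
Local Open Scope ring_scope.
Local Open Scope lincat_scope.

(**
Write u = I ⊠ I and W = T^*(I).  Composing the adjunction T^* -| T^{**} with mu makes
T^* also left adjoint to T, so there are four natural maps: eta : m -> T^* T m and
eps : T T^* c -> c from T -| T^*, and kap : c -> T T^* c and xi : T^* T m -> m from
T^* -| T ([ambijunction]).  The two traces of the statement are eps kap and T(xi eta).
Both are bimodule endomorphisms of T, hence scalars x and y: the scalar at u spreads
to u acted on from both sides, that is to every A ⊠ B, and then to all retracts of sums
of these ([tensor_bnat_scalar]).

For each simple X_i, with dual X_i^v and a_i : X_i -> X_i^{vv}, there are two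
dualities: the given one, with evaluation X_i^v ⊗ X_i -> I and coevaluation
I -> X_i ⊗ X_i^v, and its companion obtained from that of X_i^v by a_i, with evaluation
X_i ⊗ X_i^v -> I and coevaluation I -> X_i^v ⊗ X_i.  The composites of the evaluation
of one with the coevaluation of the other are the two factors s_i and t_i of |X_i|^2.
Through the two adjunctions, the second evaluation and the first coevaluation give
j_i : X_i ⊠ X_i^v -> W and q_i : W -> X_i ⊠ X_i^v, which span these morphism spaces.  The theorem follows from three equations.

- id_W is a combination of the j_i q_i with coefficients c_i
  ([R_unit_decomposition]).  Applying eps, T and kap gives x = sum of c_i s_i.
- q_i j_i = 1 ⊠ h_i with c_i h_i = 1 ([summand_coefficient]): multiply the first
  equation by j_i and use that there are no morphisms between the distinct X_l ⊠ X_l^v.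
- The partial trace of q_i j_i over the first factor is t_i (1 ⊠ h_i).  Since eta and
  xi commute with the action of X_i^v, the partial trace can be taken between them,
  on the endomorphism of X_i ⊗ X_i^v that is the second evaluation followed by the
  first coevaluation.  There the zigzag equations give the identity, so the result is
  xi eta at I ⊠ X_i^v.  Hence t_i h_i = y ([partial_trace_box]).

So c_i y = t_i, and x y = sum of s_i c_i y = sum of s_i t_i.

Morphisms of the Deligne product have to be found from its universal property alone.
For simple X and Z = X^v, the functor K m = X ⊠ (Z ⊗ T m) sends A ⊠ D to
X ⊠ (Z ⊗ (A ⊗ D)); contracting Z against the X-isotypic part of A defines natural maps
A ⊠ D -> K(A ⊠ D) -> A ⊠ D whose composite is the projection onto the X-isotypic part
of the first factor.  By the universal property they extend to the whole product,
where the sum of these composites over all simple X is the identity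
([box_generate]), and transporting a morphism along K gives
[box_hom_same] and [box_hom_other].
*)

(** * Linear maps, linear functors and isomorphisms *)

(** Families of witnesses are chosen with the indefinite description axiom, since
    all existence statements about categories are propositional. *)
Lemma choice_fun (J : Type) (A : J -> Type) (Q : forall i, A i -> Prop) :
  (forall i, exists x, Q i x) -> exists f : forall i, A i, forall i, Q i (f i).
Proof.
move=> ex; exists (fun i => proj1_sig (constructive_indefinite_description _ (ex i))) => i.
exact: proj2_sig.
Qed.

Section LinearMaps.
Variables (k : closedFieldType) (V W : lmodType k) (f : V -> W).
Hypothesis lin_f : linear f.

Lemma linD x y : f (x + y) = f x + f y.
Proof. by have := lin_f 1 x y; rewrite !scale1r. Qed.

Lemma lin0 : f 0 = 0.
Proof. by apply: (addrI (f 0)); rewrite -linD !addr0. Qed.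

Lemma linZ c x : f (c *: x) = c *: f x.
Proof. by have := lin_f c x 0; rewrite lin0 !addr0. Qed.

Lemma lin_sum n (x : 'I_n -> V) : f (\sum_i x i) = \sum_i f (x i).
Proof. exact: (big_morph f linD lin0). Qed.

End LinearMaps.

Section LinearComposition.
Variables (k : closedFieldType) (C : lincat k).

Lemma compDr (X Y Z : C) (g : hom Y Z) (f f' : hom X Y) :
  g ∘ (f + f') = g ∘ f + g ∘ f'.
Proof. exact: linD (comp_linear_r g) f f'. Qed.

Lemma compDl (X Y Z : C) (g g' : hom Y Z) (f : hom X Y) :
  (g + g') ∘ f = g ∘ f + g' ∘ f.
Proof. exact: linD (comp_linear_l f) g g'. Qed.

Lemma comp0l (X Y Z : C) (f : hom X Y) : (0 : hom Y Z) ∘ f = 0.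
Proof. exact: lin0 (comp_linear_l f). Qed.

Lemma comp0r (X Y Z : C) (g : hom Y Z) : g ∘ (0 : hom X Y) = 0.
Proof. exact: lin0 (comp_linear_r g). Qed.

Lemma compZl (X Y Z : C) (c : k) (g : hom Y Z) (f : hom X Y) :
  (c *: g) ∘ f = c *: (g ∘ f).
Proof. exact: linZ (comp_linear_l f) c g. Qed.

Lemma compZr (X Y Z : C) (c : k) (g : hom Y Z) (f : hom X Y) :
  g ∘ (c *: f) = c *: (g ∘ f).
Proof. exact: linZ (comp_linear_r g) c f. Qed.

Lemma comp_suml (X Y Z : C) (n : nat) (g : 'I_n -> hom Y Z) (f : hom X Y) :
  (\sum_i g i) ∘ f = \sum_i (g i ∘ f).
Proof. exact (lin_sum (comp_linear_l f) g). Qed.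

Lemma comp_sumr (X Y Z : C) (n : nat) (g : hom Y Z) (f : 'I_n -> hom X Y) :
  g ∘ (\sum_i f i) = \sum_i (g ∘ f i).
Proof. exact (lin_sum (comp_linear_r g) f). Qed.

(** Rewrites the head of a right-nested composite. *)
Lemma rw_comp (W X Y Z : C) (g : hom Y Z) (f : hom X Y) (h : hom X Z)
    (E : g ∘ f = h) (x : hom W X) : g ∘ (f ∘ x) = h ∘ x.
Proof. by rewrite comp_assoc E. Qed.

End LinearComposition.

Section LinearFunctors.
Variables (k : closedFieldType) (C D : lincat k) (F : lfunctor C D).

Lemma fmapZ (X Y : C) (c : k) (f : hom X Y) : fmap F (c *: f) = c *: fmap F f.
Proof. exact: linZ (@fmap_linear k C D F X Y) c f. Qed.

Lemma fmap_sum (X Y : C) (n : nat) (f : 'I_n -> hom X Y) :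
  fmap F (\sum_i f i) = \sum_i fmap F (f i).
Proof. exact (lin_sum (@fmap_linear k C D F X Y) f). Qed.

End LinearFunctors.

Section Bifunctors.
Variables (k : closedFieldType) (C D E : lincat k) (B : bifunctor C D E).

Definition lsection (X : C) : lfunctor D E.
Proof.
exists (fun Y => B X Y) (fun Y Y' g => bmap B (idm X) g).
- by move=> Y; rewrite bmap_id.
- by move=> Y Y' Y'' g f; rewrite bmap_idl_comp.
- by move=> Y Y' c g g'; rewrite (bmap_linear_r B (idm X)).
Defined.

Lemma bmap0l (X X' : C) (Y Y' : D) (g : hom Y Y') : bmap B (0 : hom X X') g = 0.
Proof. exact: lin0 (@bmap_linear_l k C D E B X X' Y Y' g). Qed.

Lemma bmap0r (X X' : C) (Y Y' : D) (f : hom X X') : bmap B f (0 : hom Y Y') = 0.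
Proof. exact: lin0 (@bmap_linear_r k C D E B X X' Y Y' f). Qed.

Lemma bmapDl (X X' : C) (Y Y' : D) (f f' : hom X X') (g : hom Y Y') :
  bmap B (f + f') g = bmap B f g + bmap B f' g.
Proof. exact: linD (@bmap_linear_l k C D E B X X' Y Y' g) f f'. Qed.

Lemma bmapDr (X X' : C) (Y Y' : D) (f : hom X X') (g g' : hom Y Y') :
  bmap B f (g + g') = bmap B f g + bmap B f g'.
Proof. exact: linD (@bmap_linear_r k C D E B X X' Y Y' f) g g'. Qed.

Lemma bmapZl (X X' : C) (Y Y' : D) (c : k) (f : hom X X') (g : hom Y Y') :
  bmap B (c *: f) g = c *: bmap B f g.
Proof. exact: linZ (@bmap_linear_l k C D E B X X' Y Y' g) c f. Qed.

Lemma bmapZr (X X' : C) (Y Y' : D) (c : k) (f : hom X X') (g : hom Y Y') :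
  bmap B f (c *: g) = c *: bmap B f g.
Proof. exact: linZ (@bmap_linear_r k C D E B X X' Y Y' f) c g. Qed.

Lemma bmap_suml (X X' : C) (Y Y' : D) (n : nat) (f : 'I_n -> hom X X') (g : hom Y Y') :
  bmap B (\sum_i f i) g = \sum_i bmap B (f i) g.
Proof. exact (lin_sum (@bmap_linear_l k C D E B X X' Y Y' g) f). Qed.

Lemma bmap_split_lr (X X' : C) (Y Y' : D) (f : hom X X') (g : hom Y Y') :
  bmap B f g = bmap B f (idm Y') ∘ bmap B (idm X) g.
Proof. by rewrite -bmap_comp comp_idl comp_idr. Qed.

Lemma bmap_split_rl (X X' : C) (Y Y' : D) (f : hom X X') (g : hom Y Y') :
  bmap B f g = bmap B (idm X') g ∘ bmap B f (idm Y).
Proof. by rewrite -bmap_comp comp_idl comp_idr. Qed.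

End Bifunctors.

Section Isos.
Variables (k : closedFieldType) (C : lincat k).

Lemma iso_epi (X Y Z : C) (w : iso X Y) (f g : hom Y Z) :
  f ∘ fwd w = g ∘ fwd w -> f = g.
Proof.
by move=> E; rewrite -[f]comp_idr -[g]comp_idr -(fwd_bwd w) !comp_assoc E.
Qed.

Lemma iso_mono (X Y Z : C) (w : iso X Y) (f g : hom Z X) :
  fwd w ∘ f = fwd w ∘ g -> f = g.
Proof.
by move=> E; rewrite -[f]comp_idl -[g]comp_idl -(bwd_fwd w) -!comp_assoc E.
Qed.

Lemma fwdK (X Y Z : C) (w : iso X Y) (f : hom Z X) : bwd w ∘ (fwd w ∘ f) = f.
Proof. by rewrite comp_assoc bwd_fwd comp_idl. Qed.

Lemma bwdK (X Y Z : C) (w : iso X Y) (f : hom Z Y) : fwd w ∘ (bwd w ∘ f) = f.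
Proof. by rewrite comp_assoc fwd_bwd comp_idl. Qed.

Definition iso_sym (X Y : C) (w : iso X Y) : iso Y X := Iso (fwd_bwd w) (bwd_fwd w).

Lemma iso_nonzero (X Y : C) (w : iso X Y) : idm Y != 0 -> idm X != 0.
Proof.
apply: contra => /eqP X0.
by rewrite -(fwd_bwd w) -[fwd w]comp_idr X0 comp0r comp0l.
Qed.

Lemma scale_idm_inj (X : C) (c c' : k) : idm X != 0 -> c *: idm X = c' *: idm X -> c = c'.
Proof.
move=> nz /eqP; rewrite -subr_eq0 -scalerBl scaler_eq0 (negPf nz) orbF subr_eq0.
by move/eqP.
Qed.

End Isos.

(** * Schur's lemma and isotypic frames *)

Section Schur.
Variables (k : closedFieldType) (C : lincat k).

Lemma simple_nonzero (S : C) : simple_ob S -> idm S != 0.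
Proof. by case=> nz _; apply/eqP. Qed.

Hypothesis fssC : finite_semisimple C.

(** The kernel of a nonzero map out of a simple object is zero, so the map is a
    monomorphism into a simple object. *)
Lemma schur_iso (S S' : C) (f : hom S S') :
  simple_ob S -> simple_ob S' -> f != 0 -> is_iso f.
Proof.
move=> [S0 sS] [_ sS'] f0; case: fssC => -[_ ker _ _ _] _ _.
have [K [i [fi0 univ]]] := ker _ _ f.
have mono_i : mono i.
  move=> W g h gh.
  have [|x [_ ux]] := univ W (i ∘ g); first by rewrite comp_assoc fi0 comp0l.
  by rewrite -(ux g) // -(ux h).
case: (sS _ _ mono_i) => [K0 | [i' [_ ii']]]; last first.
  by move/eqP: f0; rewrite -[f]comp_idr -ii' comp_assoc fi0 comp0l.
have mono_f : mono f.
  move=> W g h gh; apply/eqP; rewrite -subr_eq0; apply/eqP.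
  have [|x [<- _]] := univ W (g - h).
    by rewrite compDr gh -compDr subrr comp0r.
  by rewrite -[x]comp_idl (K0 : idm K = 0) comp0l comp0r.
by case: (sS' _ _ mono_f).
Qed.

(** Composition with [f] is an endomorphism of the nonzero finite-dimensional
    space End(S), so it has an eigenvector over an algebraically closed field,
    and Schur's lemma forces f - c to vanish. *)
Lemma schur_scalar (S : C) (f : hom S S) : simple_ob S -> exists c, f = c *: idm S.
Proof.
move=> sS; have S0 := simple_nonzero sS.
have [c [g g0 fg]] : exists c, exists2 g : hom S S, g != 0 & f ∘ g = c *: g.
  pose L : {linear hom S S -> hom S S} :=
    HB.pack (fun g => f ∘ g) (GRing.isLinear.Build _ _ _ _ _ (comp_linear_r f)).
  pose M := lin1_mx (v2r \o L \o r2v).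
  (* M is the matrix of g |-> f g; its size is nonzero because id is. *)
  have [c /eigenvalueP [v vM v0]] : exists c, eigenvalue M c.
    have /closed_rootP [c] : size (char_poly M) != 1%N.
      rewrite size_char_poly eqSS; apply: contra S0 => /eqP d0.
      rewrite -[idm S]v2rK; apply/eqP/(canLR v2rK)/rowP => i.
      by have: (i < 0)%N by apply: leq_trans (ltn_ord i) _; rewrite d0.
    by rewrite -eigenvalue_root_char; exists c.
  exists c, (r2v v); first by apply: contra v0 => /eqP v0; rewrite -(r2vK v) v0 linear0.
  apply: (can_inj v2rK); rewrite linearZ /= r2vK -vM.
  by rewrite mul_rV_lin1.
exists c; apply/eqP; rewrite -subr_eq0; apply/negPn/negP => nz.
have [h [hf _]] := schur_iso sS sS nz.
move/eqP: g0; apply; rewrite -[g]comp_idl -hf -comp_assoc compDl.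
by rewrite -scaleNr compZl comp_idl fg scaleNr subrr comp0r.
Qed.

End Schur.


(** Dual bases of Hom(X, A) and Hom(A, X) for the composition pairing: for simple X
    they split off the X-isotypic part of A. *)
Record frame (k : closedFieldType) (C : lincat k) (X A : C) := Frame {
  rk : nat;
  incl : 'I_rk -> hom X A;
  proj : 'I_rk -> hom A X;
  frame_in : forall h : hom X A, \sum_a incl a ∘ (proj a ∘ h) = h;
  frame_out : forall h : hom A X, \sum_a h ∘ incl a ∘ proj a = h
}.
Arguments incl {k C X A} f a.
Arguments proj {k C X A} f a.

Section Frames.
Variables (k : closedFieldType) (C : lincat k).
Hypothesis fssC : finite_semisimple C.

Lemma schur_zero (S S' : C) (f : hom S S') :
  simple_ob S -> simple_ob S' -> ~ isomorphic S S' -> f = 0.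
Proof.
move=> sS sS' ni; apply/eqP/negPn/negP => f0; apply: ni.
by have [g [gf fg]] := schur_iso fssC sS sS' f0; constructor; exists f g.
Qed.

Lemma simple_split_epi (A S : C) (r : hom A S) :
  simple_ob S -> r != 0 -> exists s : hom S A, r ∘ s = idm S.
Proof.
move=> sS r0; case: fssC => _ /(_ A) [n [Y [sY [inY [outY [_ _ sum1]]]]]] _.
have [b rb0] : exists b, r ∘ inY b != 0.
  apply/existsP; apply: contraR r0 => /existsPn rz.
  rewrite -[r]comp_idr -sum1 comp_sumr big1 // => b _.
  by rewrite comp_assoc (eqP (negPn (rz b))) comp0l.
have [g [_ gr]] := schur_iso fssC (sY b) sS rb0.
by exists (inY b ∘ g); rewrite comp_assoc.
Qed.

(** An isomorphism and its inverse when X and S are isomorphic, two zero maps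
    otherwise: this avoids transporting morphisms along equalities of indices when
    the summands of an object are sorted by isomorphism class. *)
Lemma simple_pairing (X S : C) : simple_ob X -> simple_ob S ->
  exists w : hom X S * hom S X,
    (forall h : hom X S, w.1 ∘ (w.2 ∘ h) = h) /\ (forall h : hom S X, h ∘ w.1 ∘ w.2 = h).
Proof.
move=> sX sS; case: (classic (isomorphic X S)) => [[w]|ni].
  exists (fwd w, bwd w); split=> h /=; first by rewrite bwdK.
  by rewrite -comp_assoc fwd_bwd comp_idr.
have ni' : ~ isomorphic S X by case=> w; apply: ni; constructor; exact: iso_sym.
by exists (0, 0); split=> h /=; rewrite ?comp0l ?comp0r; apply/esym/schur_zero.
Qed.

Section Representatives.
Variables (n : nat) (X : 'I_n -> C).
Hypothesis repX : simple_reps X.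

Lemma rep_simple i : simple_ob (X i).
Proof. by case: repX. Qed.

Lemma frames_at (A : C) : exists fr : forall i, frame (X i) A,
  \sum_i \sum_a incl (fr i) a ∘ proj (fr i) a = idm A.
Proof.
case: repX => sX injX surX.
case: fssC => _ /(_ A) [m [Y [sY [inY [outY [_ _ sum1]]]]]] _.
have [w wP] := choice_fun (fun ib : 'I_n * 'I_m => simple_pairing (sX ib.1) (sY ib.2)).
have frI i (h : hom (X i) A) :
    \sum_b (inY b ∘ (w (i, b)).1) ∘ (((w (i, b)).2 ∘ outY b) ∘ h) = h.
  rewrite -[RHS]comp_idl -sum1 comp_suml; apply: eq_bigr => b _.
  by rewrite -!comp_assoc (proj1 (wP (i, b))).
have frO i (h : hom A (X i)) :
    \sum_b h ∘ (inY b ∘ (w (i, b)).1) ∘ ((w (i, b)).2 ∘ outY b) = h.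
  rewrite -[RHS]comp_idr -sum1 comp_sumr; apply: eq_bigr => b _.
  by rewrite !comp_assoc (proj2 (wP (i, b))).
exists (fun i => Frame (frI i) (frO i)) => /=.
rewrite exchange_big -sum1; apply: eq_bigr => b _ /=.
(* Only the class i0 of Y b contributes. *)
have [i0 [u]] := surX _ (sY b).
rewrite (bigD1 i0) //= big1 ?addr0 => [|i ii0]; last first.
  suff -> : (w (i, b)).1 = 0 by rewrite comp0r comp0l.
  apply: schur_zero => // -[v]; case/eqP: ii0; apply: injX; constructor.
  exact: iso_comp u v.
rewrite -comp_assoc; congr (_ ∘ _); rewrite comp_assoc.
suff -> : (w (i0, b)).1 ∘ (w (i0, b)).2 = idm (Y b) by rewrite comp_idl.
by apply: (iso_mono (w := u)); rewrite comp_assoc (proj2 (wP (i0, b))) comp_idr.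
Qed.

Lemma frames : exists fr : forall A i, frame (X i) A, forall A,
  \sum_i \sum_a incl (fr A i) a ∘ proj (fr A i) a = idm A.
Proof. exact: choice_fun frames_at. Qed.

End Representatives.

(** The element [\sum_a incl a ⊗ proj a] of Hom(X, A) ⊗ Hom(A, X) is canonical, hence
    natural in A: a change of frame is given by one matrix of scalars, by Schur's
    lemma, and it moves across the tensor sign.  A bilinear map [phi] stands for the
    tensor product. *)
Lemma frame_natural (X A A' : C) (u : frame X A) (v : frame X A') (g : hom A A')
    (E : vectType k) (phi : hom X A' -> hom A X -> E) :
  simple_ob X ->
  (forall p, linear (phi^~ p)) -> (forall i, linear (phi i)) ->
  \sum_a phi (g ∘ incl u a) (proj u a) = \sum_b phi (incl v b) (proj v b ∘ g).
Proof.
move=> sX linl linr.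
have [c cP] := choice_fun (fun ab =>
  schur_scalar fssC (proj v ab.2 ∘ (g ∘ incl u ab.1)) sX).
transitivity (\sum_a \sum_b c (a, b) *: phi (incl v b) (proj u a)).
  apply: eq_bigr => a _; rewrite -[g ∘ _](frame_in v) (lin_sum (linl _)).
  apply: eq_bigr => b _.
  by rewrite (cP (a, b)) compZr comp_idr (linZ (linl _)).
rewrite exchange_big; apply: eq_bigr => b _ /=.
rewrite -[_ ∘ g](frame_out u) (lin_sum (linr _)); apply: eq_bigr => a _.
by rewrite -(comp_assoc _ g) (cP (a, b)) compZl comp_idl (linZ (linr _)).
Qed.

End Frames.

(** * Coherence and duality in monoidal categories *)

Section Coherence.
Variables (k : closedFieldType) (C : moncat k).
Implicit Types X Y Z : C.

Lemma tens_unitl_inj X Y (f g : hom X Y) :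
  idm (@unit_ob k C) ⊗₁ f = idm unit_ob ⊗₁ g -> f = g.
Proof. by move=> E; apply: (iso_epi (w := lunit X)); rewrite !lunit_nat E. Qed.

Lemma tens_unitr_inj X Y (f g : hom X Y) :
  f ⊗₁ idm (@unit_ob k C) = g ⊗₁ idm unit_ob -> f = g.
Proof. by move=> E; apply: (iso_epi (w := runit X)); rewrite !runit_nat E. Qed.

Definition tens_iso X X' Y Y' (u : iso X X') (v : iso Y Y') : iso (X ⊗ Y) (X' ⊗ Y').
Proof.
by exists (fwd u ⊗₁ fwd v) (bwd u ⊗₁ bwd v);
  rewrite -bmap_comp ?bwd_fwd ?fwd_bwd bmap_id.
Defined.

(** Kelly's derivation of the left unit coherence: after tensoring with the unit on
    the left it becomes a pentagon with two triangles. *)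
Lemma lunit_tens X Y :
  fwd (lunit (X ⊗ Y)) ∘ fwd (assoc unit_ob X Y) = fwd (lunit X) ⊗₁ idm Y.
Proof.
apply: tens_unitl_inj; rewrite bmap_idl_comp.
apply: (iso_epi (w := assoc unit_ob (unit_ob ⊗ X) Y)).
apply: (iso_epi (w := tens_iso (assoc unit_ob unit_ob X) (iso_id Y))) => /=.
rewrite -!comp_assoc (comp_assoc (_ ⊗₁ fwd (assoc _ _ _))) -pentagon.
rewrite (rw_comp (triangle _ _)) -bmap_id assoc_nat -triangle bmap_idr_comp.
by rewrite comp_assoc -assoc_nat -!comp_assoc.
Qed.

(** The mirror image: tensoring with the unit on the right turns the claim into a
    pentagon. *)
Lemma runit_tens X Y :
  fwd (runit (X ⊗ Y)) = (idm X ⊗₁ fwd (runit Y)) ∘ fwd (assoc X Y unit_ob).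
Proof.
apply: tens_unitr_inj; rewrite bmap_idr_comp -triangle.
apply: (iso_mono (w := assoc X Y unit_ob)).
rewrite comp_assoc -[idm (X ⊗ Y)]bmap_id -assoc_nat -comp_assoc pentagon.
rewrite -!comp_assoc (comp_assoc (idm X ⊗₁ _)) -bmap_comp comp_idl triangle.
by rewrite comp_assoc assoc_nat -comp_assoc.
Qed.

(** Both unitors of I satisfy the triangle identity, and tensoring with I is
    faithful. *)
Lemma lunit_unit : fwd (lunit (@unit_ob k C)) = fwd (runit unit_ob).
Proof.
apply: tens_unitr_inj; rewrite -triangle -lunit_tens; congr (_ ∘ _).
by apply: (iso_mono (w := lunit unit_ob)); rewrite lunit_nat.
Qed.

Lemma lunit_nat_bwd X Y (f : hom X Y) :
  (idm unit_ob ⊗₁ f) ∘ bwd (lunit X) = bwd (lunit Y) ∘ f.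
Proof.
apply: (iso_epi (w := lunit X)); rewrite -!comp_assoc bwd_fwd comp_idr lunit_nat.
by rewrite fwdK.
Qed.

Lemma runit_nat_bwd X Y (f : hom X Y) :
  (f ⊗₁ idm unit_ob) ∘ bwd (runit X) = bwd (runit Y) ∘ f.
Proof.
apply: (iso_epi (w := runit X)); rewrite -!comp_assoc bwd_fwd comp_idr runit_nat.
by rewrite fwdK.
Qed.

Lemma assoc_nat_bwd X X' Y Y' Z Z' (f : hom X X') (g : hom Y Y') (h : hom Z Z') :
  bwd (assoc X' Y' Z') ∘ (f ⊗₁ (g ⊗₁ h)) = ((f ⊗₁ g) ⊗₁ h) ∘ bwd (assoc X Y Z).
Proof.
apply: (iso_epi (w := assoc X Y Z)); rewrite -!comp_assoc bwd_fwd comp_idr assoc_nat.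
by rewrite fwdK.
Qed.

Lemma triangle_bwd X Y :
  fwd (assoc X unit_ob Y) ∘ (bwd (runit X) ⊗₁ idm Y) = idm X ⊗₁ bwd (lunit Y).
Proof.
apply: (iso_mono (w := tens_iso (iso_id X) (lunit Y))) => /=.
rewrite (rw_comp (triangle _ _)) -!bmap_comp !comp_idl !fwd_bwd.
by rewrite !bmap_id.
Qed.

End Coherence.

Section Duality.
Variables (k : closedFieldType) (C : moncat k) (L X : C) (d : duality L X).

(** For a morphism f : X -> X', [dual_map f] is the mate of the evaluation of X'
    precomposed with f; taking any [e] makes one zigzag argument serve for dual maps and
    for the comparison of evaluations. *)
Definition mate (N : C) (e : hom (N ⊗ X) unit_ob) : hom N L :=
  fwd (lunit L) ∘ (e ⊗₁ idm L) ∘ bwd (assoc N X L) ∘ (idm N ⊗₁ coev d) ∘ bwd (runit N).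

(** Slide [ev] past [e]: what remains is N tensored with a zigzag. *)
Lemma ev_mate (N : C) (e : hom (N ⊗ X) unit_ob) : ev d ∘ (mate e ⊗₁ idm X) = e.
Proof.
rewrite /mate !bmap_idr_comp -!comp_assoc.
rewrite -lunit_tens -!comp_assoc (rw_comp (lunit_nat _)).
rewrite -!comp_assoc (comp_assoc (fwd (assoc _ _ _))) -assoc_nat -!comp_assoc.
rewrite !bmap_id (comp_assoc (idm unit_ob ⊗₁ _)) -bmap_comp comp_idl comp_idr.
rewrite lunit_unit bmap_split_lr -!comp_assoc (rw_comp (esym (runit_nat _))).
rewrite runit_tens -!comp_assoc.
rewrite -{1}[idm (N ⊗ X)]bmap_id (comp_assoc (fwd (assoc N X unit_ob))) -assoc_nat.
rewrite -!comp_assoc (rw_comp (pentagon _ _ _ _)) -!comp_assoc.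
rewrite (comp_assoc (fwd _ ⊗₁ _) (bwd _ ⊗₁ _)) -bmap_comp fwd_bwd comp_idl bmap_id comp_idl.
rewrite (comp_assoc (fwd (assoc N _ X))) -assoc_nat -!comp_assoc triangle_bwd.
rewrite -!bmap_comp !comp_idl.
have := zigzag_r d; rewrite -!comp_assoc => ->.
by rewrite bmap_id comp_idr.
Qed.

(** The universal property of the coevaluation; the witness is the mate of [p],
    and sliding [coev] past [p] leaves a zigzag tensored with N. *)
Lemma coev_mate (N : C) (p : hom unit_ob (X ⊗ N)) :
  exists f : hom L N, (idm X ⊗₁ f) ∘ coev d = p.
Proof.
exists (fwd (lunit N) ∘ (ev d ⊗₁ idm N) ∘ bwd (assoc L X N) ∘ (idm L ⊗₁ p)
  ∘ bwd (runit L)).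
have runitX : idm X ⊗₁ bwd (runit L) = fwd (assoc X L unit_ob) ∘ bwd (runit (X ⊗ L)).
  apply: (iso_epi (w := runit (X ⊗ L))); rewrite -comp_assoc bwd_fwd comp_idr.
  by rewrite runit_tens comp_assoc -bmap_comp bwd_fwd comp_idl bmap_id comp_idl.
have lunitX : bwd (lunit (X ⊗ N)) = fwd (assoc unit_ob X N) ∘ (bwd (lunit X) ⊗₁ idm N).
  apply: (iso_mono (w := lunit (X ⊗ N))).
  by rewrite comp_assoc lunit_tens fwd_bwd -bmap_comp fwd_bwd comp_idl bmap_id.
have unitI : bwd (runit (@unit_ob k C)) = bwd (lunit unit_ob).
  by apply: (iso_mono (w := runit unit_ob)); rewrite fwd_bwd -lunit_unit fwd_bwd.
rewrite !bmap_idl_comp runitX -!comp_assoc -runit_nat_bwd unitI.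
rewrite (comp_assoc (idm X ⊗₁ (idm L ⊗₁ p))) assoc_nat -!comp_assoc.
rewrite bmap_id (comp_assoc (idm _ ⊗₁ p)) -bmap_split_rl (bmap_split_lr _ (coev d)).
rewrite -!comp_assoc lunit_nat_bwd lunitX -!comp_assoc.
rewrite -[idm (X ⊗ N)]bmap_id (comp_assoc (coev d ⊗₁ _)) assoc_nat -!comp_assoc.
rewrite (rw_comp (pentagon _ _ _ _)) -!comp_assoc.
rewrite (comp_assoc (_ ⊗₁ bwd _)) -bmap_comp bwd_fwd comp_idl bmap_id comp_idl.
rewrite (comp_assoc (idm X ⊗₁ (ev d ⊗₁ _))) assoc_nat -!comp_assoc.
rewrite (rw_comp (triangle _ _)) !(comp_assoc _ _ p) -!bmap_idr_comp.
by have := zigzag_r d; rewrite -!comp_assoc => ->; rewrite bmap_id comp_idl.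
Qed.

End Duality.

Section DualityIso.
Variables (k : closedFieldType) (C : moncat k).

Definition duality_iso (L L' X : C) (d : duality L X) (a : iso L' L) : duality L' X.
Proof.
exists (ev d ∘ (fwd a ⊗₁ idm X)) ((idm X ⊗₁ bwd a) ∘ coev d).
- rewrite bmap_idl_comp bmap_idr_comp -!comp_assoc.
  rewrite (comp_assoc (fwd (assoc _ _ _))) -assoc_nat -!comp_assoc.
  rewrite (comp_assoc (idm X ⊗₁ (fwd a ⊗₁ _))) -!bmap_comp fwd_bwd !comp_idl !bmap_id.
  by rewrite comp_idl; have := zigzag_r d; rewrite -!comp_assoc.
- apply: (iso_mono (w := a)); rewrite comp_idr.
  rewrite -!comp_assoc (comp_assoc (fwd a)) lunit_nat -!comp_assoc.
  rewrite (comp_assoc (idm unit_ob ⊗₁ fwd a)) -bmap_split_rl bmap_split_lr.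
  rewrite -!comp_assoc bmap_idl_comp -!comp_assoc -[idm (L' ⊗ X)]bmap_id.
  rewrite (rw_comp (esym (assoc_nat_bwd _ _ _))) -!comp_assoc.
  rewrite (comp_assoc (idm L' ⊗₁ _)) -!bmap_comp fwd_bwd !comp_idl !bmap_id comp_idl.
  rewrite bmap_idr_comp -!comp_assoc (rw_comp (esym (assoc_nat_bwd _ _ _))).
  rewrite bmap_id -!comp_assoc (comp_assoc (fwd a ⊗₁ _)) -bmap_split_lr (bmap_split_rl _ (fwd a)).
  by rewrite -!comp_assoc runit_nat_bwd !comp_assoc zigzag_l comp_idl.
Defined.

End DualityIso.

Section PartialTrace.
Variables (k : closedFieldType) (C : moncat k).

Lemma snake_l (L X : C) (d : duality L X) :
  (ev d ⊗₁ idm L) ∘ bwd (assoc L X L) ∘ (idm L ⊗₁ coev d)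
  = bwd (lunit L) ∘ fwd (runit L).
Proof.
apply: (iso_mono (w := lunit L)); apply: (iso_epi (w := iso_sym (runit L))) => /=.
by rewrite bwdK fwd_bwd !comp_assoc zigzag_l.
Qed.

Lemma snake_r (L X : C) (d : duality L X) :
  (idm X ⊗₁ ev d) ∘ fwd (assoc X L X) ∘ (coev d ⊗₁ idm X)
  = bwd (runit X) ∘ fwd (lunit X).
Proof.
apply: (iso_mono (w := runit X)); apply: (iso_epi (w := iso_sym (lunit X))) => /=.
by rewrite bwdK fwd_bwd !comp_assoc zigzag_r.
Qed.

(** Closing up the first tensor factor of the projection [coev d ∘ ev d'] with the
    two other structure maps leaves a zigzag of d followed by a zigzag of d'.  This
    identity is what cancels the mixed traces in the dimension formula. *)
Lemma snake_partial_trace (X Y : C) (d : duality Y X) (d' : duality X Y) :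
  (ev d ⊗₁ idm Y) ∘ bwd (assoc Y X Y) ∘ (idm Y ⊗₁ (coev d ∘ ev d'))
    ∘ fwd (assoc Y X Y) ∘ (coev d' ⊗₁ idm Y) = idm (unit_ob ⊗ Y).
Proof.
rewrite bmap_idl_comp comp_assoc snake_l -!comp_assoc (comp_assoc (_ ⊗₁ ev d')).
by rewrite snake_r bwdK bwd_fwd.
Qed.

(** The pairing is nondegenerate: the coevaluation recovers [h] from the left
    side. *)
Lemma ev_cancel (L X : C) (d : duality L X) (h : hom X X) :
  ev d ∘ (idm L ⊗₁ h) = ev d -> h = idm X.
Proof.
move=> E; have := snake_r d; rewrite -{1}E bmap_idl_comp -!comp_assoc.
rewrite (comp_assoc (idm X ⊗₁ (idm L ⊗₁ h))) assoc_nat bmap_id -!comp_assoc.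
rewrite -bmap_split_rl (bmap_split_lr _ (coev d)) (comp_assoc (fwd (assoc _ _ _))) (comp_assoc (idm X ⊗₁ ev d)).
rewrite (comp_assoc (_ ⊗₁ ev d)) snake_r -comp_assoc -lunit_nat.
move=> /(iso_mono (w := iso_sym (runit X))) E'.
by apply: (iso_epi (w := lunit X)); rewrite E' comp_idl.
Qed.

(** A zigzag factors the identity of X through L. *)
Lemma dual_nonzero (L X : C) (d : duality L X) : idm X != 0 -> idm L != 0.
Proof.
apply: contra => /eqP L0; rewrite -(zigzag_r d) -[coev d]comp_idl -bmap_id L0.
by rewrite bmap0r comp0l bmap0l comp0r comp0l.
Qed.

Lemma ev_nonzero (L X : C) (d : duality L X) : idm X != 0 -> ev d != 0.
Proof.
apply: contra => /eqP e0; rewrite -(zigzag_r d) e0.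
by rewrite bmap0r comp0r !comp0l.
Qed.

End PartialTrace.

Lemma ev_split (k : closedFieldType) (C : fusion k) (n : nat) (X : 'I_n -> C) :
  (forall i, simple_ob (X i)) ->
  exists s : forall i, hom unit_ob (dual (X i) ⊗ X i),
    forall i, ev (dualP (X i)) ∘ s i = idm unit_ob.
Proof.
move=> sX.
apply: (choice_fun (Q := fun i s => ev (dualP (X i)) ∘ s = idm unit_ob)) => i.
apply: (simple_split_epi (fusion_fss C) (unit_simple C)).
exact: ev_nonzero (simple_nonzero (sX i)).
Qed.

(** The unit is simple, so Schur's lemma provides a scalar for [unit_scalar] to choose. *)
Lemma unit_scalarE (k : closedFieldType) (C : fusion k) (f : hom (@unit_ob k C) unit_ob) :
  f = unit_scalar f *: idm unit_ob.
Proof.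
have [c E] := schur_scalar (fusion_fss C) f (unit_simple C).
exact: (epsilon_spec (inhabits 0) _ (ex_intro (fun c => f = c *: idm unit_ob) c E)).
Qed.

(** ** The two factors of the squared norm *)

Section Traces.
Variables (k : closedFieldType) (C : fusion k) (X : C) (a : iso X (dual (dual X))).

(** An isomorphism of X with its double dual makes X a left dual of its dual, which
    turns both traces into composites of an evaluation and a coevaluation. *)
Definition right_dual : duality X (dual X) := duality_iso (dualP (dual X)) a.

Lemma trace_homE : trace_hom (fwd a) = ev right_dual ∘ coev (dualP X).
Proof. by []. Qed.

Lemma trace_hom_dual : trace_hom (dual_map (bwd a)) = ev (dualP X) ∘ coev right_dual.
Proof.
have -> : dual_map (bwd a)
    = mate (dualP (dual (dual X))) (ev (dualP X) ∘ (idm (dual X) ⊗₁ bwd a)).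
  by rewrite /dual_map /mate bmap_idr_comp !comp_assoc.
by rewrite /trace_hom /evm ev_mate -comp_assoc.
Qed.

End Traces.

(** * Morphisms in a Deligne product *)

Section DeligneHoms.
Variables (k : closedFieldType) (C : moncat k) (P : lincat k) (B : bifunctor C C P).
Variables (T : lfunctor P C) (tb : forall X Y, iso (T (B X Y)) (X ⊗ Y)).
Hypothesis tb_nat : forall X X' Y Y' (f : hom X X') (g : hom Y Y'),
  (f ⊗₁ g) ∘ fwd (tb X Y) = fwd (tb X' Y') ∘ fmap T (bmap B f g).
Hypotheses (fssC : finite_semisimple C) (fssP : finite_semisimple P).
Hypothesis delB : is_deligne B.

Lemma tb_nat_bwd X X' Y Y' (f : hom X X') (g : hom Y Y') :
  bwd (tb X' Y') ∘ (f ⊗₁ g) = fmap T (bmap B f g) ∘ bwd (tb X Y).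
Proof.
apply: (iso_epi (w := tb X Y)); rewrite -!comp_assoc bwd_fwd comp_idr tb_nat.
by rewrite fwdK.
Qed.

Section OneSimple.
Variables (X Z : C) (r : hom (Z ⊗ X) unit_ob) (s : hom unit_ob (Z ⊗ X)).
Hypothesis rs : r ∘ s = idm unit_ob.
Hypothesis sX : simple_ob X.
Variable fr : forall A, frame X A.

Definition box_tens : lfunctor P P := lcomp (lsection B X) (lcomp (lsection (tens C) Z) T).

(** With [p] running over the projections of a frame of A, these contract Z against
    the X-isotypic part of A. *)
Definition contract A D (p : hom A X) : hom (Z ⊗ T (B A D)) D :=
  fwd (lunit D) ∘ ((r ∘ (idm Z ⊗₁ p)) ⊗₁ idm D) ∘ bwd (assoc Z A D)
    ∘ (idm Z ⊗₁ fwd (tb A D)).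

(** Built from a section s of r rather than from a coevaluation, whose composite with r
    would be a trace that might vanish. *)
Definition expand A D (i : hom X A) : hom D (Z ⊗ T (B A D)) :=
  (idm Z ⊗₁ bwd (tb A D)) ∘ fwd (assoc Z A D) ∘ (((idm Z ⊗₁ i) ∘ s) ⊗₁ idm D)
    ∘ bwd (lunit D).

Lemma contract_linear A D : linear (@contract A D).
Proof.
move=> c p p'; rewrite /contract bmapDr bmapZr compDr compZr bmapDl bmapZl.
by rewrite !(compDr, compDl, compZr, compZl).
Qed.

Lemma expand_linear A D : linear (@expand A D).
Proof.
move=> c p p'; rewrite /expand bmapDr bmapZr compDl compZl bmapDl bmapZl.
by rewrite !(compDr, compDl, compZr, compZl).
Qed.

Lemma contract_nat A A' D D' (f : hom A A') (g : hom D D') (p : hom A' X) :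
  contract D' p ∘ (idm Z ⊗₁ fmap T (bmap B f g)) = g ∘ contract D (p ∘ f).
Proof.
rewrite /contract -!comp_assoc -bmap_comp comp_idl -tb_nat bmap_idl_comp.
rewrite (comp_assoc (bwd _)) assoc_nat_bwd -!comp_assoc (comp_assoc (_ ⊗₁ idm D')).
rewrite -bmap_comp comp_idl -comp_assoc -bmap_comp !comp_idl.
rewrite (bmap_split_rl _ _ g) (comp_assoc g) lunit_nat -!comp_assoc.
done.
Qed.

Lemma expand_nat A A' D D' (f : hom A A') (g : hom D D') (i : hom X A) :
  (idm Z ⊗₁ fmap T (bmap B f g)) ∘ expand D i = expand D' (f ∘ i) ∘ g.
Proof.
rewrite /expand -!comp_assoc (comp_assoc (idm Z ⊗₁ fmap _ _)) -bmap_idl_comp.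
rewrite -tb_nat_bwd bmap_idl_comp -!comp_assoc (comp_assoc (idm Z ⊗₁ (f ⊗₁ g))).
rewrite assoc_nat -!comp_assoc (comp_assoc (_ ⊗₁ g)) -bmap_comp comp_idr (comp_assoc (idm Z ⊗₁ f)).
rewrite -bmap_comp comp_idl (bmap_split_lr _ _ g) -!comp_assoc.
by rewrite lunit_nat_bwd.
Qed.

Lemma contract_expand A D (p : hom A X) (i : hom X A) :
  contract D p ∘ expand D i
  = fwd (lunit D) ∘ ((r ∘ (idm Z ⊗₁ (p ∘ i)) ∘ s) ⊗₁ idm D) ∘ bwd (lunit D).
Proof.
rewrite /contract /expand -!comp_assoc (comp_assoc (idm Z ⊗₁ fwd _)) -bmap_comp.
rewrite comp_idl fwd_bwd bmap_id comp_idl fwdK (comp_assoc (_ ⊗₁ idm D)) -bmap_comp.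
by rewrite comp_idl -!comp_assoc (comp_assoc (idm Z ⊗₁ p)) -bmap_comp comp_idl.
Qed.

(** With [isotypic_out], the factorization of the projection onto the X-isotypic part of
    the first factor through [box_tens]. *)
Definition isotypic_in A D : hom (B X (Z ⊗ T (B A D))) (B A D) :=
  \sum_a bmap B (incl (fr A) a) (contract D (proj (fr A) a)).

Definition isotypic_out A D : hom (B A D) (B X (Z ⊗ T (B A D))) :=
  \sum_a bmap B (proj (fr A) a) (expand D (incl (fr A) a)).

Lemma isotypic_in_natural : natural_on (F := box_tens) (G := lid P) isotypic_in.
Proof.
move=> A A' D D' f g /=; rewrite /isotypic_in comp_sumr comp_suml.
under [LHS]eq_bigr do rewrite -bmap_comp.
under [RHS]eq_bigr do rewrite -bmap_comp comp_idr contract_nat.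
apply: (frame_natural fssC (fr A) (fr A') f
  (phi := fun i p => bmap B i (g ∘ contract D p))) => // h c i i'.
  exact: bmap_linear_l.
by rewrite contract_linear compDr compZr bmapDr bmapZr.
Qed.

Lemma isotypic_out_natural : natural_on (F := lid P) (G := box_tens) isotypic_out.
Proof.
move=> A A' D D' f g /=; rewrite /isotypic_out comp_sumr comp_suml.
under [LHS]eq_bigr do rewrite -bmap_comp comp_idl expand_nat.
under [RHS]eq_bigr do rewrite -bmap_comp.
apply: (frame_natural fssC (fr A) (fr A') f
  (phi := fun i p => bmap B p (expand D' i ∘ g))) => // h c i i'.
  by rewrite expand_linear compDl compZl bmapDr bmapZr.
exact: bmap_linear_l.
Qed.

(** The scalar matrix of [proj a ∘ incl b] collapses the double sum, and r s = 1
    removes the contraction. *)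
Lemma isotypic_in_out A D :
  isotypic_in A D ∘ isotypic_out A D
  = bmap B (\sum_a incl (fr A) a ∘ proj (fr A) a) (idm D).
Proof.
rewrite /isotypic_in comp_suml bmap_suml; apply: eq_bigr => a _.
rewrite /isotypic_out comp_sumr -[proj _ a in RHS](frame_out (fr A)) comp_sumr bmap_suml.
apply: eq_bigr => b _.
have [c E] := schur_scalar fssC (proj (fr A) a ∘ incl (fr A) b) sX.
rewrite -bmap_comp contract_expand E bmapZr compZr compZl bmap_id comp_idr rs.
rewrite bmapZl bmap_id compZr compZl comp_idr fwd_bwd bmapZr.
by rewrite compZl comp_idl compZr bmapZl.
Qed.

Lemma isotypic_in_self D :
  isotypic_in X D = bmap B (idm X) (contract D (idm X)).
Proof.
transitivity (bmap B (\sum_a incl (fr X) a ∘ (proj (fr X) a ∘ idm X))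
  (contract D (idm X))); last by rewrite frame_in.
rewrite bmap_suml; apply: eq_bigr => a _; rewrite comp_idr.
have [c ->] := schur_scalar fssC (proj (fr X) a) sX.
by rewrite (linZ (@contract_linear X D)) compZr comp_idr bmapZl bmapZr.
Qed.

Lemma isotypic_in_other (X' : C) D :
  simple_ob X' -> ~ isomorphic X X' -> isotypic_in X' D = 0.
Proof.
move=> sX' ni; apply: big1 => a _.
by rewrite [incl _ a](schur_zero fssC _ sX sX' ni) bmap0l.
Qed.

Lemma contract_split D : contract D (idm X) ∘ expand D (idm X) = idm D.
Proof.
by rewrite contract_expand comp_idl bmap_id comp_idr rs bmap_id comp_idr fwd_bwd.
Qed.

(** The Deligne property with the product itself as target. *)
Lemma isotypic_in_extends : exists t : forall m, hom (box_tens m) m,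
  natural (F := box_tens) (G := lid P) t /\ forall A D, t (B A D) = isotypic_in A D.
Proof.
have [_ ext] := delB fssP.
by have [t [nt tE _]] := ext _ _ _ isotypic_in_natural; exists t.
Qed.

Lemma isotypic_out_extends : exists t : forall m, hom m (box_tens m),
  natural (F := lid P) (G := box_tens) t /\ forall A D, t (B A D) = isotypic_out A D.
Proof.
have [_ ext] := delB fssP.
by have [t [nt tE _]] := ext _ _ _ isotypic_out_natural; exists t.
Qed.

(** At X ⊠ D the extended transformation is 1 ⊠ (contraction), a split epimorphism;
    its naturality along [f] moves [f] into the second factor. *)
Lemma box_hom_same D D' (f : hom (B X D) (B X D')) :
  exists h, f = bmap B (idm X) h.
Proof.
have [t [nt tE]] := isotypic_in_extends.
exists (contract D' (idm X) ∘ (idm Z ⊗₁ fmap T f) ∘ expand D (idm X)).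
have /= := nt _ _ f; rewrite !tE !isotypic_in_self => E.
rewrite -[LHS]comp_idr -bmap_id -(contract_split D) bmap_idl_comp comp_assoc E.
by rewrite -!bmap_comp !comp_idl.
Qed.

(** Naturality of the same split epimorphism, which vanishes at the target because
    X' has no X-isotypic part. *)
Lemma box_hom_other (X' : C) D D' (f : hom (B X D) (B X' D')) :
  simple_ob X' -> ~ isomorphic X X' -> f = 0.
Proof.
move=> sX' ni; have [t [nt tE]] := isotypic_in_extends.
have /= := nt _ _ f; rewrite !tE isotypic_in_self isotypic_in_other // => E.
rewrite -[LHS]comp_idr -bmap_id -(contract_split D) bmap_idl_comp comp_assoc E.
by rewrite !comp0l.
Qed.

End OneSimple.

Section Generation.
Variables (n : nat) (X Z : 'I_n -> C) (r : forall i, hom (Z i ⊗ X i) unit_ob)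
  (s : forall i, hom unit_ob (Z i ⊗ X i)).
Hypothesis rs : forall i, r i ∘ s i = idm unit_ob.
Hypothesis repX : simple_reps X.

(** Both sides are natural in m and agree on the objects A ⊠ D, where the sum over i
    is the decomposition of A into isotypic parts; so they agree everywhere. *)
Lemma box_generate (m : P) : exists (N : 'I_n -> C)
    (t : forall i, hom (B (X i) (N i)) m) (u : forall i, hom m (B (X i) (N i))),
  \sum_i t i ∘ u i = idm m.
Proof.
have [fr frE] := frames fssC repX; have sX := rep_simple repX.
have [t tP] := choice_fun (fun i => isotypic_in_extends (r i) (sX i) (fr^~ i)).
have [u uP] := choice_fun (fun i => isotypic_out_extends (s i) (sX i) (fr^~ i)).
exists (fun i => Z i ⊗ T m), (fun i => t i m), (fun i => u i m).
have [_ uniq] := delB fssP.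
have nid : natural_on (B := B) (F := lid P) (G := lid P) (fun A D => idm (B A D)).
  by move=> A A' D D' f g /=; rewrite comp_idl comp_idr.
have [v [_ _ vE]] := uniq _ _ _ nid.
rewrite (vE (fun m => \sum_i t i m ∘ u i m)).
- by rewrite -(vE (fun m => idm m)) // => ? ? f /=; rewrite comp_idl comp_idr.
- move=> w w' f /=; rewrite comp_sumr comp_suml; apply: eq_bigr => i _.
  have /= nt := (proj1 (tP i)) _ _ f; have /= nu := (proj1 (uP i)) _ _ f.
  by rewrite comp_assoc nt -!comp_assoc nu.
- move=> A D; transitivity (bmap B (idm A) (idm D)); last by rewrite bmap_id.
  rewrite -frE bmap_suml; apply: eq_bigr => i _.
  by rewrite (proj2 (tP i)) (proj2 (uP i)) isotypic_in_out.
Qed.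

End Generation.
End DeligneHoms.


(** * Two-sided adjoints of bimodule functors *)

(** R is right adjoint to T through [eta] and [eps], and left adjoint to T through
    [kap] and [xi]. *)
Record ambijunction (k : closedFieldType) (C P : lincat k)
    (T : lfunctor P C) (R : lfunctor C P) := Ambijunction {
  eta : forall m, hom m (R (T m));
  eps : forall c, hom (T (R c)) c;
  kap : forall c, hom c (T (R c));
  xi : forall m, hom (R (T m)) m;
  eta_nat : forall m m' (f : hom m m'), fmap R (fmap T f) ∘ eta m = eta m' ∘ f;
  eps_nat : forall c c' (f : hom c c'), f ∘ eps c = eps c' ∘ fmap T (fmap R f);
  kap_nat : forall c c' (f : hom c c'), fmap T (fmap R f) ∘ kap c = kap c' ∘ f;
  xi_nat : forall m m' (f : hom m m'), f ∘ xi m = xi m' ∘ fmap R (fmap T f);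
  eta_eps_l : forall m, eps (T m) ∘ fmap T (eta m) = idm (T m);
  eta_eps_r : forall c, fmap R (eps c) ∘ eta (R c) = idm (R c);
  kap_xi_l : forall c, xi (R c) ∘ fmap R (kap c) = idm (R c);
  kap_xi_r : forall m, fmap T (xi m) ∘ kap (T m) = idm (T m)
}.

Section Ambijunction.
Variables (k : closedFieldType) (C P : lincat k) (T : lfunctor P C) (R : lfunctor C P).
Variable A : ambijunction T R.

Definition to_R (m : P) (c : C) (e : hom (T m) c) : hom m (R c) := fmap R e ∘ eta A m.
Definition from_R (m : P) (c : C) (p : hom c (T m)) : hom (R c) m := xi A m ∘ fmap R p.

Lemma to_R_surj (m : P) (c : C) (u : hom m (R c)) : u = to_R (eps A c ∘ fmap T u).
Proof.
by rewrite /to_R fmap_comp -comp_assoc eta_nat comp_assoc eta_eps_r comp_idl.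
Qed.

Lemma from_R_surj (m : P) (c : C) (v : hom (R c) m) : v = from_R (fmap T v ∘ kap A c).
Proof.
by rewrite /from_R fmap_comp comp_assoc -xi_nat -comp_assoc kap_xi_l comp_idr.
Qed.

Lemma eps_to_R (m : P) (c : C) (e : hom (T m) c) : eps A c ∘ fmap T (to_R e) = e.
Proof.
by rewrite /to_R fmap_comp comp_assoc -eps_nat -comp_assoc eta_eps_l comp_idr.
Qed.

Lemma from_R_kap (m : P) (c : C) (p : hom c (T m)) : fmap T (from_R p) ∘ kap A c = p.
Proof.
by rewrite /from_R fmap_comp -comp_assoc kap_nat comp_assoc kap_xi_r comp_idl.
Qed.

Lemma to_R_comp (m m' : P) (c : C) (e : hom (T m) c) (g : hom m' m) :
  to_R e ∘ g = to_R (e ∘ fmap T g).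
Proof. by rewrite /to_R -comp_assoc -eta_nat fmap_comp comp_assoc. Qed.

Lemma comp_from_R (m m' : P) (c : C) (p : hom c (T m)) (g : hom m m') :
  g ∘ from_R p = from_R (fmap T g ∘ p).
Proof. by rewrite /from_R comp_assoc xi_nat -comp_assoc -fmap_comp. Qed.

Lemma to_RZ (m : P) (c : C) a (e : hom (T m) c) : to_R (a *: e) = a *: to_R e.
Proof. by rewrite /to_R fmapZ compZl. Qed.

End Ambijunction.

(** ** Bimodule endomorphisms that are scalars *)

Section BimoduleEnd.
Variables (k : closedFieldType) (C : moncat k) (M N : bimod C) (F : bimod_functor M N).
Variables (t : bimod_nat F F) (c : k).

Definition scalar_at (m : M) := t m = c *: idm (F m).

Lemma scalar_at_retract (m : M) (n : nat) (Y : 'I_n -> M) (p : forall i, hom (Y i) m)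
    (q : forall i, hom m (Y i)) :
  \sum_i p i ∘ q i = idm m -> (forall i, scalar_at (Y i)) -> scalar_at m.
Proof.
move=> E sY; rewrite /scalar_at -[LHS]comp_idr -!fmap_id -E !fmap_sum comp_sumr scaler_sumr.
apply: eq_bigr => i _.
by rewrite !fmap_comp comp_assoc -bnat_nat sY compZr compZl comp_idr.
Qed.

Lemma scalar_at_iso (m m' : M) : iso m m' -> scalar_at m -> scalar_at m'.
Proof.
move=> w sm; apply: (@scalar_at_retract m' 1 (fun=> m) (fun=> fwd w) (fun=> bwd w)) => //.
by rewrite big_ord1 fwd_bwd.
Qed.

Lemma scalar_at_lact (X : C) (m : M) : scalar_at m -> scalar_at (X ▷ m).
Proof.
move=> sm; apply: (iso_mono (w := lstr F X m)).
by rewrite -bnat_l sm bmapZr bmap_id compZl compZr comp_idl comp_idr.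
Qed.

Lemma scalar_at_ract (X : C) (m : M) : scalar_at m -> scalar_at (m ◁ X).
Proof.
move=> sm; apply: (iso_mono (w := rstr F m X)).
by rewrite -bnat_r sm bmapZl bmap_id compZl compZr comp_idl comp_idr.
Qed.

(** The choice in [bnat_scalar] is unique as soon as F has a nonzero value. *)
Lemma bnat_scalarE (m : M) :
  (forall m, scalar_at m) -> idm (F m) != 0 -> bnat_scalar t = c.
Proof.
move=> sc nz; rewrite /bnat_scalar.
have := epsilon_spec (inhabits 0) (fun c => forall m, t m = c *: idm (F m)).
move=> /(_ (ex_intro _ c sc)) /(_ m); rewrite sc => E.
exact/esym/(scale_idm_inj nz E).
Qed.

End BimoduleEnd.

(** The partial trace, over the action of D, of an endomorphism of m obtained from
    [f : F m -> F m] can be computed on F m, because [eta] and [xi] commute with the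
    action and are natural for [cup] and [cap].  [f'] is the action of D on f,
    transported to F (D ▷ m). *)
Lemma partial_trace_whisker (k : closedFieldType) (C : moncat k) (M N : bimod C)
    (F : bimod_functor M N) (G : bimod_functor N M)
    (eta : bimod_nat (bid M) (bcomp G F)) (xi : bimod_nat (bcomp G F) (bid M))
    (D : C) (m m' : M) (f : hom (F m) (F m)) (f' : hom (F (D ▷ m)) (F (D ▷ m)))
    (cup : hom m' (D ▷ m)) (cap : hom (D ▷ m) m') :
  (idm D ▷₁ f) ∘ fwd (lstr F D m) = fwd (lstr F D m) ∘ f' ->
  fmap F cap ∘ f' ∘ fmap F cup = idm (F m') ->
  cap ∘ (idm D ▷₁ (xi m ∘ fmap G f ∘ eta m)) ∘ cup = xi m' ∘ eta m'.
Proof.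
move=> ff' tr.
have /= etaD := bnat_l eta D m; have /= xiD := bnat_l xi D m.
have /= etaN := bnat_nat eta cup; have /= xiN := bnat_nat xi cap.
rewrite comp_idr in etaD; rewrite comp_idl in xiD.
rewrite !bmap_idl_comp etaD -!comp_assoc -etaN.
rewrite (comp_assoc (idm D ▷₁ fmap G f)) lstr_nat -!comp_assoc.
rewrite (comp_assoc (fmap G (_ ▷₁ _))) -fmap_comp ff' fmap_comp.
rewrite -!comp_assoc (comp_assoc (fwd (lstr G _ _))) (comp_assoc (idm D ▷₁ xi m)) xiD.
rewrite (comp_assoc cap) xiN -!comp_assoc (comp_assoc (fmap G f')) -fmap_comp.
rewrite (comp_assoc (fmap G _) (fmap G _)) -fmap_comp.
by have := tr; rewrite -comp_assoc => ->; rewrite fmap_id comp_idl.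
Qed.

(** ** The ambijunction given by an isomorphism of the double right adjoint *)

Section BimoduleAmbijunction.
Variables (k : closedFieldType) (C : moncat k) (M N : bimod C).
Variables (F : bimod_functor M N) (G : bimod_functor N M) (H : bimod_functor M N).
Variables (adjF : adjunction F G) (adjG : adjunction G H) (mu : bimod_iso H F).

Definition xi_bimod : bimod_nat (bcomp G F) (bid M) :=
  nvcomp (adj_counit adjG) (nwhisker_l G (nbwd mu)).

Definition kap_bimod : bimod_nat (bid N) (bcomp F G) :=
  nvcomp (nwhisker_r (nfwd mu) G) (adj_unit adjG).

Definition bimod_ambijunction : ambijunction F G.
Proof.
exists (adj_unit adjF) (adj_counit adjF) kap_bimod xi_bimod.
- exact: (bnat_nat (adj_unit adjF)).
- exact: (bnat_nat (adj_counit adjF)).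
- exact: (bnat_nat kap_bimod).
- exact: (bnat_nat xi_bimod).
- exact: (adj_triangle_l adjF).
- exact: (adj_triangle_r adjF).
- move=> c /=; rewrite -comp_assoc -fmap_comp comp_assoc nbwd_fwd comp_idl.
  exact: (adj_triangle_l adjG).
- move=> m /=.
  have /= E := bnat_nat (nfwd mu) (adj_counit adjG m ∘ fmap G (nbwd mu m)).
  have /= E' := bnat_nat (adj_unit adjG) (nbwd mu m).
  rewrite comp_assoc E fmap_comp -!comp_assoc E'.
  rewrite (comp_assoc (fmap H _)) (adj_triangle_r adjG) comp_idl.
  exact: nfwd_bwd.
Defined.

End BimoduleAmbijunction.

(** * Decomposition of the right adjoint of the unit *)

Section Decomposition.
Variables (k : closedFieldType) (C : fusion k) (P : lincat k) (B : bifunctor C C P).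
Variables (T : lfunctor P C) (tb : forall X Y, iso (T (B X Y)) (X ⊗ Y)).
Hypothesis tb_nat : forall X X' Y Y' (f : hom X X') (g : hom Y Y'),
  (f ⊗₁ g) ∘ fwd (tb X Y) = fwd (tb X' Y') ∘ fmap T (bmap B f g).
Hypotheses (fssP : finite_semisimple P) (delB : is_deligne B).
Variables (R : lfunctor C P) (A : ambijunction T R).
Variables (n : nat) (X : 'I_n -> C).
Hypothesis repX : simple_reps X.
Variable d' : forall i, duality (X i) (dual (X i)).

Let fssC := fusion_fss C.
Let I : C := unit_ob.
Let V i : P := B (X i) (dual (X i)).

Definition ev_box i : hom (T (V i)) I := ev (d' i) ∘ fwd (tb (X i) (dual (X i))).
Definition coev_box i : hom I (T (V i)) :=
  bwd (tb (X i) (dual (X i))) ∘ coev (dualP (X i)).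
Definition summand_in i : hom (V i) (R I) := to_R A (ev_box i).
Definition summand_out i : hom (R I) (V i) := from_R A (coev_box i).

Let sX := rep_simple repX.

(** Maps into R I correspond to maps X i ⊗ (dual of X i) -> I, and by duality to endomorphisms
    of the simple object X i. *)
Lemma summand_in_spans i (w : hom (V i) (R I)) : exists c, w = c *: summand_in i.
Proof.
pose e := eps A I ∘ fmap T w ∘ bwd (tb (X i) (dual (X i))).
have [c E] := schur_scalar fssC (mate (d' i) e) (sX i).
exists c; rewrite /summand_in -to_RZ (to_R_surj A w); congr (to_R A _).
apply: (iso_epi (w := iso_sym (tb (X i) (dual (X i))))) => /=.
rewrite -/e -(ev_mate (d' i) e) E bmapZl bmap_id compZr comp_idr compZl.
by rewrite /ev_box -comp_assoc fwd_bwd comp_idr.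
Qed.

(** Such a map corresponds to a map I -> X i ⊗ D, which factors through the
    coevaluation. *)
Lemma summand_out_generates i D (v : hom (R I) (B (X i) D)) :
  exists f, v = bmap B (idm (X i)) f ∘ summand_out i.
Proof.
have [f E] := coev_mate (dualP (X i)) (fwd (tb (X i) D) ∘ (fmap T v ∘ kap A I)).
exists f; rewrite /summand_out comp_from_R (from_R_surj A v); congr (from_R A _).
by rewrite /coev_box comp_assoc -tb_nat_bwd // -comp_assoc E fwdK.
Qed.

(** Each factorization of the identity through X i ⊠ D given by [box_generate] can
    be moved to the dual of X i by [summand_out_generates], where only scalars are
    left. *)
Lemma R_unit_decomposition :
  exists c : 'I_n -> k, \sum_i c i *: (summand_in i ∘ summand_out i) = idm (R I).
Proof.
have [s rs] := ev_split sX.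
have [N [t [u E]]] := box_generate tb_nat fssC fssP delB rs repX (R I).
have [c cE] : exists c : 'I_n -> k,
    forall i, t i ∘ u i = c i *: (summand_in i ∘ summand_out i).
  apply: (choice_fun
    (Q := fun i c => t i ∘ u i = c *: (summand_in i ∘ summand_out i))) => i.
  have [f ->] := summand_out_generates (u i).
  have [c tc] := summand_in_spans (t i ∘ bmap B (idm (X i)) f).
  by exists c; rewrite comp_assoc tc compZl.
by exists c; rewrite -E; apply: eq_bigr => i _.
Qed.

(** Composing the decomposition with [summand_in i] leaves the i-th term, and
    [ev_cancel] compares the second factors. *)
Lemma summand_coefficient (c : 'I_n -> k) :
  \sum_i c i *: (summand_in i ∘ summand_out i) = idm (R I) ->
  forall i, exists2 h, summand_out i ∘ summand_in i = bmap B (idm (X i)) h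
                     & c i *: h = idm (dual (X i)).
Proof.
move=> E i; have [s rs] := ev_split sX.
have [fr frE] := frames fssC repX.
have [h qj] := box_hom_same tb_nat fssC fssP delB (rs i) (sX i) (fr^~ i)
  (summand_out i ∘ summand_in i).
exists h => //; apply: (ev_cancel (d := d' i)).
have jE : summand_in i = c i *: (summand_in i ∘ bmap B (idm (X i)) h).
  rewrite -[LHS]comp_idl -E comp_suml (bigD1 i) //= big1 => [|l li].
    by rewrite addr0 compZl -comp_assoc qj.
  rewrite compZl -comp_assoc.
  rewrite (box_hom_other tb_nat fssC fssP delB (rs i) (sX i) (fr^~ i)
    (summand_out l ∘ summand_in i) (sX l)) ?comp0r ?scaler0 // => il.
  by move/eqP: li; apply; case: repX => _ inj _; apply/esym/inj.
have eE : ev_box i = c i *: (ev_box i ∘ fmap T (bmap B (idm (X i)) h)).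
  have := congr1 (fun j => eps A I ∘ fmap T j) jE.
  by rewrite /summand_in to_R_comp fmapZ compZr !eps_to_R.
apply: (iso_epi (w := tb (X i) (dual (X i)))).
rewrite bmapZr compZr compZl -comp_assoc tb_nat comp_assoc.
exact: esym eE.
Qed.

End Decomposition.


(** * The dimension formula *)

Section Dimension.
Variables (k : closedFieldType) (C : fusion k) (P : deligne_square C) (T : tensor_functor P).
Variables (Ts : bimod_functor (regular C) P) (Tss : bimod_functor P (regular C)).
Variables (adjT : adjunction T Ts) (adjTs : adjunction Ts Tss) (mu : bimod_iso Tss T).

Let I : C := unit_ob.
Let F : lfunctor P C := bfun T.
Let tb (A B : C) : iso (F (box P A B)) (A ⊗ B) := tbox T A B.

Let tb_nat A A' B B' (f : hom A A') (g : hom B B') :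
  (f ⊗₁ g) ∘ fwd (tb A B) = fwd (tb A' B') ∘ fmap F (bmap (box P) f g).
Proof. exact: tbox_nat. Qed.

(** T u is isomorphic to I, whose endomorphisms are scalars, and A ⊠ B is isomorphic
    to (A ▷ u) ◁ B for u = I ⊠ I; bimodule transformations follow the actions. *)
Lemma tensor_bnat_scalar n (X : 'I_n -> C) (t : bimod_nat T T) :
  simple_reps X -> exists c, forall m, t m = c *: idm (T m).
Proof.
move=> repX.
have [c tu] : exists c, scalar_at t c (box P I I).
  have w : iso (F (box P I I)) I := iso_comp (lunit I) (tb I I).
  have [c E] := schur_scalar (fusion_fss C) (fwd w ∘ t (box P I I) ∘ bwd w) (unit_simple C).
  exists c; apply: (iso_mono (w := w)); apply: (iso_epi (w := iso_sym w)) => /=.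
  by rewrite E compZr comp_idr compZl fwd_bwd.
exists c; have [s rs] : exists s, _ := ev_split (rep_simple repX).
have sbox A B : scalar_at t c (box P A B).
  have w : iso (box P (A ⊗ I) (I ⊗ B)) (box P A B).
    exists (bmap (box P) (fwd (runit A)) (fwd (lunit B)))
           (bmap (box P) (bwd (runit A)) (bwd (lunit B))).
    - by rewrite -bmap_comp !bwd_fwd bmap_id.
    - by rewrite -bmap_comp !fwd_bwd bmap_id.
  apply: (scalar_at_iso w); apply: (scalar_at_iso (boxr _ _ _)).
  apply: scalar_at_ract; apply: (scalar_at_iso (boxl _ _ _)).
  exact: scalar_at_lact.
move=> m.
have [N [p [q E]]] := box_generate tb_nat (fusion_fss C) (bimod_fss P) (@box_deligne k C P) rs repX m.
by apply: (scalar_at_retract E) => i; exact: sbox.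
Qed.

Let amb : ambijunction F (bfun Ts) := bimod_ambijunction adjT adjTs mu.

Lemma trace_muE (m : P) : trace_mu adjT adjTs mu m = eps amb (F m) ∘ kap amb (F m).
Proof. by rewrite /= comp_idl comp_idr. Qed.

Lemma trace_mu_inv_dualE (m : P) :
  trace_mu_inv_dual adjT adjTs mu m = fmap F (xi amb m ∘ eta amb m).
Proof. by rewrite /= comp_idl comp_idr comp_assoc. Qed.

Section Trace.
Variables (X : C) (d' : duality X (dual X)).
Let Y : C := dual X.
Let d : duality Y X := dualP X.
Let M : P := box P X Y.

Let ls (Z A B : C) : iso (F (Z ▷ box P A B)) (Z ⊗ F (box P A B)) := lstr T Z (box P A B).

Let tb_l Z A B : fwd (assoc Z A B) ∘ fwd (tb (Z ⊗ A) B) ∘ fmap F (fwd (boxl Z A B))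
  = (idm Z ⊗₁ fwd (tb A B)) ∘ fwd (ls Z A B).
Proof. exact: tbox_l. Qed.

Lemma boxl_inv_lact (Z A B A' B' : C) (g : hom A A') (h : hom B B') :
  (idm Z ▷₁ bmap (box P) g h) ∘ bwd (boxl Z A B)
  = bwd (boxl Z A' B') ∘ bmap (box P) (idm Z ⊗₁ g) h.
Proof.
apply: (iso_mono (w := boxl Z A' B')); apply: (iso_epi (w := boxl Z A B)).
by rewrite bwdK boxl_nat -!comp_assoc bwd_fwd comp_idr.
Qed.

(** The left side is the partial trace of 1 ⊠ h over the first factor, closed with
    the coevaluation of d' and the evaluation of d.  On the right, the same closing has
    been carried out inside T, where [snake_partial_trace] reduces it to the
    identity. *)
Lemma partial_trace_box (h : hom Y Y) :
  from_R amb (bwd (tb X Y) ∘ coev d) ∘ to_R amb (ev d' ∘ fwd (tb X Y))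
    = bmap (box P) (idm X) h ->
  bmap (box P) (ev d ∘ coev d') h = xi amb (box P I Y) ∘ eta amb (box P I Y).
Proof.
move=> E.
pose cup := bwd (boxl Y X Y) ∘ bmap (box P) (coev d') (idm Y).
pose cap := bmap (box P) (ev d) (idm Y) ∘ fwd (boxl Y X Y).
pose f : hom (F M) (F M) := bwd (tb X Y) ∘ coev d ∘ (ev d' ∘ fwd (tb X Y)).
pose f' : hom (F (Y ▷ M)) (F (Y ▷ M)) :=
  bwd (ls Y X Y) ∘ ((idm Y ⊗₁ f) ∘ fwd (ls Y X Y)).
have tr : fmap F cap ∘ f' ∘ fmap F cup = idm (F (box P I Y)).
  (* Through tbox, the left action constraint of T becomes the associator. *)
  have Fl : fmap F (fwd (boxl Y X Y)) ∘ bwd (ls Y X Y)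
      = bwd (tb (Y ⊗ X) Y) ∘ bwd (assoc Y X Y) ∘ (idm Y ⊗₁ fwd (tb X Y)).
    apply: (iso_mono (w := tb (Y ⊗ X) Y)); apply: (iso_mono (w := assoc Y X Y)).
    by rewrite !comp_assoc tb_l -!comp_assoc fwd_bwd comp_idr bwdK bwdK.
  have Fl' : fwd (ls Y X Y) ∘ fmap F (bwd (boxl Y X Y))
      = (idm Y ⊗₁ bwd (tb X Y)) ∘ fwd (assoc Y X Y) ∘ fwd (tb (Y ⊗ X) Y).
    apply: (iso_epi (w := iso_map F (boxl Y X Y))).
    rewrite /= -!comp_assoc -fmap_comp bwd_fwd fmap_id comp_idr.
    rewrite (comp_assoc (fwd (assoc _ _ _))) tb_l comp_assoc -bmap_comp bwd_fwd.
    by rewrite comp_idl bmap_id comp_idl.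
  rewrite /cap /cup /f' !fmap_comp -!comp_assoc (rw_comp Fl) (rw_comp Fl').
  rewrite -!comp_assoc -tb_nat.
  rewrite (comp_assoc (fmap F (bmap _ _ _))) -tb_nat_bwd // -!comp_assoc.
  rewrite (comp_assoc (idm Y ⊗₁ f)) -bmap_idl_comp (comp_assoc (idm Y ⊗₁ fwd _)).
  rewrite -bmap_idl_comp /f -!comp_assoc fwd_bwd comp_idr bwdK.
  rewrite (comp_assoc (fwd (assoc _ _ _))) (comp_assoc (idm Y ⊗₁ _)).
  rewrite (comp_assoc (bwd (assoc _ _ _))) (comp_assoc (ev d ⊗₁ _)) !comp_assoc.
  rewrite -!(comp_assoc (bwd (tb _ _))) snake_partial_trace comp_idl.
  exact: bwd_fwd.
have := @partial_trace_whisker k C P (regular C) T Ts (adj_unit adjT)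
  (xi_bimod adjTs mu) Y M (box P I Y) f f' cup cap _ tr.
have -> : xi_bimod adjTs mu M ∘ fmap Ts f ∘ adj_unit adjT M = bmap (box P) (idm X) h.
  by rewrite -E /from_R /to_R /f (fmap_comp Ts) !comp_assoc.
move=> <-; last by rewrite /f' bwdK.
rewrite /cap /cup -!comp_assoc (comp_assoc (_ ▷₁ _)) boxl_inv_lact -comp_assoc.
by rewrite bwdK -!bmap_comp bmap_id !(comp_idl, comp_idr).
Qed.

End Trace.

Lemma eps_kap_scalar (c : k) :
  scalar_at (trace_mu adjT adjTs mu) c (box P I I) -> eps amb I ∘ kap amb I = c *: idm I.
Proof.
rewrite /scalar_at trace_muE => E.
have w : iso (F (box P I I)) I := iso_comp (lunit I) (tb I I).
apply: (iso_epi (w := w)).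
rewrite -comp_assoc -kap_nat comp_assoc -eps_nat -comp_assoc E.
by rewrite compZr compZl comp_idl comp_idr.
Qed.

Lemma unit_box_nonzero (A : C) : idm A != 0 -> idm (T (box P I A)) != 0.
Proof. exact: (iso_nonzero (iso_comp (lunit A) (tb I A))). Qed.

Lemma dim_2Vect_global_dim n (X : 'I_n -> C) (a : forall i, iso (X i) (dual (dual (X i)))) :
  simple_reps X -> dim_2Vect adjT adjTs mu = global_dim a.
Proof.
move=> repX.
have I0 := simple_nonzero (unit_simple C).
(* x and y are the scalars of the two traces, and c the coefficients of id_W. *)
have [x xP] := tensor_bnat_scalar (trace_mu adjT adjTs mu) repX.
have [y yP] := tensor_bnat_scalar (trace_mu_inv_dual adjT adjTs mu) repX.
rewrite /dim_2Vect (bnat_scalarE xP (unit_box_nonzero I0)).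
rewrite (bnat_scalarE yP (unit_box_nonzero I0)).
pose d' i := right_dual (a i).
have [c cE] := R_unit_decomposition tb_nat (bimod_fss P) (@box_deligne k C P) amb repX d'.
(* Apply eps, T and kap to the decomposition of id_W. *)
have xE : x = \sum_i c i * unit_scalar (trace_hom (fwd (a i))).
  apply: (scale_idm_inj I0); rewrite -(eps_kap_scalar (xP _)) scaler_suml.
  rewrite -[kap amb I]comp_idl -fmap_id -cE fmap_sum comp_suml comp_sumr.
  apply: eq_bigr => i _; rewrite -scalerA -unit_scalarE trace_homE.
  rewrite fmapZ compZl compZr fmap_comp -comp_assoc from_R_kap comp_assoc eps_to_R.
  by rewrite /ev_box /coev_box -!comp_assoc bwdK.
(* Multiply the partial trace identity for X i by c i, which cancels h. *)
have yE i : c i * y = unit_scalar (trace_hom (dual_map (bwd (a i)))).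
  have [h qj ch] := summand_coefficient tb_nat (bimod_fss P) (@box_deligne k C P) repX cE i.
  have nz := unit_box_nonzero (dual_nonzero (dualP (X i)) (simple_nonzero (rep_simple repX i))).
  apply: (scale_idm_inj nz); rewrite -scalerA -yP trace_mu_inv_dualE.
  rewrite -(partial_trace_box qj) -(trace_hom_dual (a i)).
  rewrite [X in bmap _ X _](unit_scalarE _) bmapZl !fmapZ scalerA mulrC -scalerA -fmapZ -bmapZr ch.
  by rewrite bmap_id fmap_id.
rewrite xE mulr_suml /global_dim; apply: eq_bigr => i _.
by rewrite /sqnorm -yE mulrCA mulrA.
Qed.

End Dimension.

Theorem proposition3p3p1 (k : closedFieldType) (C : fusion k)
    (P : deligne_square C) (T : tensor_functor P)
    (Ts : bimod_functor (regular C) P) (Tss : bimod_functor P (regular C))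
    (adjT : adjunction T Ts) (adjTs : adjunction Ts Tss) (mu : bimod_iso Tss T)
    (n : nat) (X : 'I_n -> C) (hX : simple_reps X)
    (a : forall i : 'I_n, iso (X i) (dual (dual (X i)))) :
  dim_2Vect adjT adjTs mu = global_dim a.
Proof. exact: dim_2Vect_global_dim. Qed.
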